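(* Let $U$ be a graded space and let $\delta=\sum_{n\ge0}t^n\delta_n\in\operatorname{End}^1_{u,\mathbb{K}[[t]]}(S(U)[[t]])$, that is, $\delta$ is a degree one $\mathbb{K}[[t]]$-linear endomorphism of $S(U)[[t]]$ with $\delta(\mathbf{1}_{S(U)})=0$, such that $\delta^2=0$. Denote $\varphi:=\delta\star s=\sum_{n\ge0}t^n\varphi_n$, the convolution product being computed in $\operatorname{Hom}(S(U),S(U)[[t]])$. Then the following conditions are equivalent: (a) $\delta$ defines an $IBL_\infty[1]$ algebra structure on $U$; (b) $\operatorname{Im}(\varphi_n)\subset S_{\le n+1}(U)$ for all $n\ge0$; (c) $\mathcal{K}(\delta_n)_k(U,\ldots,U)\subset S_{\le n+1}(U)$ for all $n\ge0$, $k\ge1$; (d) $\mathcal{K}(\delta_n)_k(S_{\le i_1}(U),\ldots,S_{\le i_k}(U))\subset S_{\le i_1+\cdots+i_k-k+n+1}(U)$ for all $n\ge0$, $k,i_1,\ldots,i_k\ge1$.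
   Context: $\mathbb{K}$ is a field of characteristic zero; spaces are $\mathbb{Z}$-graded; $t$ is a central variable of degree $2$. $S(U)=\bigoplus_{n\ge0}U^{\odot n}$, $S_{\le m}(U)=\bigoplus_{j=0}^mU^{\odot j}$, with symmetric product $\odot$, unshuffle coproduct $\Delta$, counit $\epsilon$ (projection to $U^{\odot0}=\mathbb{K}$), unit $\mathbf{1}_{S(U)}$. The coefficients $\delta_n$ are endomorphisms of $S(U)$, of degree $1-2n$, with $\delta_n(\mathbf{1}_{S(U)})=0$. For a coaugmented counitary coalgebra $C$, $\operatorname{End}_{cu}(C)=\{\delta\in\operatorname{End}(C):\epsilon_C\delta=0,\ \delta(\mathbf{1}_C)=0\}$. The convolution product is $F\star G=\odot\circ(F\otimes G)\circ\Delta$ and $s:S(U)\to S(U)$, $s(x_1\odot\cdots\odot x_n)=(-1)^nx_1\odot\cdots\odot x_n$, $s(\mathbf 1_{S(U)})=\mathbf 1_{S(U)}$, is the antipode. Koszul brackets (with respect to the symmetric product on $A=S(U)$): for $D\in\operatorname{End}(A)$ with $D(\mathbf{1}_A)=0$, $\mathcal{K}(D)_n(a_1,\ldots,a_n)=\sum_{i=1}^n\sum_{\sigma\in S(i,n-i)}\pm_K(-1)^{n-i}D(a_{\sigma(1)}\cdots a_{\sigma(i)})a_{\sigma(i+1)}\cdots a_{\sigma(n)}$, with $S(i,n-i)$ the $(i,n-i)$-unshuffles and $\pm_K$ the Koszul sign. Koszul cobrackets: for a graded cocommutative coalgebra $C$ (coassociative, counitary, coaugmented, cocomplete), $\Delta_C^{n-1}:C\to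 C^{\otimes n}$ the iterated coproducts ($\Delta_C^0=\mathrm{id}$), $\pi:C^{\otimes n}\to C^{\odot n}$ the projection, $\widehat S(C)=\prod_{n\ge0}C^{\odot n}$, let $E^{co}$ be the unitary algebra automorphism of $\widehat S(C)$ with $E^{co}(x)=\sum_{n\ge1}\frac1{n!}\pi\Delta_C^{n-1}(x)$ for $x\in C$, and $L^{co}=(E^{co})^{-1}$. For $\delta\in\operatorname{End}_{cu}(C)$, $\mathcal{K}^{co}(\delta)_n:C\to C^{\odot n}$ is the restriction to $C$ followed by the projection to $C^{\odot n}$ of $E^{co}\circ\widetilde\delta\circ L^{co}$, where $\widetilde\delta$ is the derivation of $\widehat S(C)$ extending $\delta:C\to C$. $IBL_\infty[1]$ algebra structure on $U$: a degree $(-1)$ derived $BV$ coalgebra structure on $S(U)$, i.e. a degree one $\mathbb{K}[[t]]$-linear $\delta=\sum_{n\ge0}t^n\delta_n$ on $S(U)[[t]]$, $\delta_n\in\operatorname{End}_{cu}(S(U))$, with $\delta^2=0$ and $\mathcal{K}^{co}(\delta)_n\equiv0\pmod{t^{n-1}}$ for all $n\ge2$ (equivalently $\mathcal{K}^{co}(\delta_n)_m=0$ whenever $m>n+1$, $m\ge2$).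
   Formalization: (b),(c),(d) are proved equivalent as stated; equivalence with (a) is proved assuming ε∘δ_n=0 for all n, which (a) contains by definition but (b) does not imply (U=Kx, |x|=-1, δ=d/dx). *)

(* Defs.v *)
From HB Require Import structures.
From mathcomp Require Import all_boot all_order perm all_algebra.
From mathcomp Require Import ring_quotient freeg.
From mathcomp Require Import boolp classical_sets.

Set Implicit Arguments.
Unset Strict Implicit.
Unset Printing Implicit Defensive.

Import GRing.Theory.
Local Open Scope ring_scope.
Local Open Scope quotient_scope.

(* A Z-graded space is a family V : int -> lmodType K; its homogeneous        *)
(* elements are the dependent pairs of type letter V.                         *)

Section Letters.
Variables (K : fieldType) (V : int -> lmodType K).

Definition letter : Type := {d : int & V d}.

Definition mklet (d : int) (v : V d) : letter := Tagged (fun d => V d : Type) v.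

Definition ldeg (x : letter) : int := tag x.

Definition wdeg (w : seq letter) : int := \sum_(x <- w) ldeg x.

Definition fgen (w : seq letter) : {freeg (seq letter) / K} := << w >>.

(* The relations defining, over the free K-module on words of homogeneous     *)
(* elements, the tensor algebra (c = false) and the symmetric algebra of the  *)
(* graded space V (c = true).                                                 *)
Inductive wrel (c : bool) : {freeg (seq letter) / K} -> Prop :=
| wrel0 : wrel c 0
| wrelP a f g : wrel c f -> wrel c g -> wrel c (a *: f + g)
| wrel_lin w1 w2 d a (u v : V d) :
    wrel c (fgen (w1 ++ mklet (a *: u + v) :: w2)
            - (a *: fgen (w1 ++ mklet u :: w2) + fgen (w1 ++ mklet v :: w2)))
| wrel_comm w1 w2 x y : c ->
    wrel c (fgen (w1 ++ x :: y :: w2)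
            - (-1) ^ (ldeg x * ldeg y) *: fgen (w1 ++ y :: x :: w2)).

Definition wideal (c : bool) : {pred {freeg (seq letter) / K}} :=
  fun f => `[< wrel c f >].

Fact wideal_zmod_closed c : zmod_closed (wideal c).
Proof.
split=> [|f g]; first exact/asboolP/wrel0.
move=> /asboolP fI /asboolP gI; apply/asboolP.
by rewrite addrC -scaleN1r; apply: wrelP.
Qed.

HB.instance Definition _ c :=
  GRing.isZmodClosed.Build _ (wideal c) (wideal_zmod_closed c).

Definition walg (c : bool) : Type := Quotient.quot (wideal c).

HB.instance Definition _ c := GRing.Zmodule.on (walg c).

Definition wpi (c : bool) (f : {freeg (seq letter) / K}) : walg c :=
  \pi_(Quotient.quot (wideal c)) f.

Fact wpi_is_zmod_morphism c : zmod_morphism (@wpi c).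
Proof. exact: raddfB. Qed.

HB.instance Definition _ c :=
  GRing.isZmodMorphism.Build _ _ (@wpi c) (@wpi_is_zmod_morphism c).

Definition wrepr (c : bool) (x : walg c) : {freeg (seq letter) / K} :=
  generic_quotient.repr (x : Quotient.quot (wideal c)).

Lemma wreprK c : cancel (@wrepr c) (@wpi c).
Proof. by move=> x; rewrite /wpi /wrepr reprK. Qed.

Lemma wpi_eq c f g : wpi c f = wpi c g <-> wrel c (f - g).
Proof.
split=> [/eqP|h]; rewrite /wpi.
  by rewrite -Quotient.idealrBE => /asboolP.
by apply/eqP; rewrite -Quotient.idealrBE; apply/asboolP.
Qed.

Lemma wpi_repr c f : wrel c (wrepr (wpi c f) - f).
Proof. by apply/wpi_eq; rewrite wreprK. Qed.

Lemma wrelZ c a f : wrel c f -> wrel c (a *: f).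
Proof. by move=> h; rewrite -[_ *: _]addr0; apply: wrelP => //; apply: wrel0. Qed.

Definition wscale c (a : K) (x : walg c) : walg c := wpi c (a *: wrepr x).

Lemma wpiZ c a f : wpi c (a *: f) = wscale a (wpi c f).
Proof.
by apply/esym/wpi_eq; rewrite -scalerBr; apply/wrelZ/wpi_repr.
Qed.

Fact wscaleA c a b (x : walg c) : wscale a (wscale b x) = wscale (a * b) x.
Proof. by rewrite -[x]wreprK -!wpiZ scalerA. Qed.
Fact wscale1 c : left_id 1 (@wscale c).
Proof. by move=> x; rewrite -[x]wreprK -!wpiZ scale1r. Qed.
Fact wscaleDr c : right_distributive (@wscale c) +%R.
Proof.
by move=> a x y; rewrite -[x]wreprK -[y]wreprK -raddfD -!wpiZ scalerDr raddfD.
Qed.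
Fact wscaleDl c (x : walg c) :
  {morph (fun a => wscale a x) : a b / a + b}.
Proof. by move=> a b /=; rewrite -[x]wreprK -!wpiZ scalerDl raddfD. Qed.

HB.instance Definition _ c :=
  GRing.Zmodule_isLmodule.Build K (walg c)
    (@wscaleA c) (@wscale1 c) (@wscaleDr c) (@wscaleDl c).

Fact wpi_is_scalable c : scalable (@wpi c).
Proof. by move=> a f; apply: wpiZ. Qed.

HB.instance Definition _ c :=
  GRing.isScalable.Build K _ _ _ (@wpi c) (@wpi_is_scalable c).

Definition word (c : bool) (w : seq letter) : walg c := wpi c (fgen w).

(* wlift f is the linear map induced by a function f on words, provided that  *)
(* f is compatible with the defining relations (see wliftE, wlift_linear).    *)
Definition wlift (c : bool) (M : lmodType K) (f : seq letter -> M)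
  (x : walg c) : M := fglift f (wrepr x).

Definition compat (c : bool) (M : lmodType K) (f : seq letter -> M) : Prop :=
  (forall w1 w2 d a (u v : V d),
     f (w1 ++ mklet (a *: u + v) :: w2)
     = a *: f (w1 ++ mklet u :: w2) + f (w1 ++ mklet v :: w2)) /\
  (c -> forall w1 w2 x y,
     f (w1 ++ x :: y :: w2)
     = (-1) ^ (ldeg x * ldeg y) *: f (w1 ++ y :: x :: w2)).

Lemma fglift_gen (M : lmodType K) (f : seq letter -> M) w :
  fglift f (fgen w) = f w.
Proof. by rewrite liftU scale1r. Qed.

Lemma fglift_zmod (M : lmodType K) (f : seq letter -> M) :
  {morph fglift f : g h / g - h}.
Proof. exact: lift_is_additive. Qed.

Lemma fgliftD (M : lmodType K) (f : seq letter -> M) :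
  {morph fglift f : g h / g + h}.
Proof.
have f0 : fglift f 0 = 0 by rewrite -(subrr 0) fglift_zmod subrr.
by move=> g h; rewrite -{1}[h]opprK -[- h]sub0r !fglift_zmod f0 sub0r opprK.
Qed.

Lemma fgliftZ (M : lmodType K) (f : seq letter -> M) :
  scalable (fglift f).
Proof.
have f0 : fglift f 0 = 0 by rewrite -(subrr 0) fglift_zmod subrr.
move=> a g; rewrite -[g in RHS]freeg_sumE.
rewrite {1}/GRing.scale /= /fgscale.
have fsum (r : seq (seq letter)) (F : _ -> {freeg (seq letter) / K}) :
    fglift f (\sum_(i <- r) F i) = \sum_(i <- r) fglift f (F i).
  by apply: (big_morph (fglift f)) => //; apply: fgliftD.
rewrite !fsum scaler_sumr; apply: eq_bigr => i _.
by rewrite !liftU scalerA.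
Qed.

Lemma fglift_wrel c (M : lmodType K) (f : seq letter -> M) g :
  compat c f -> wrel c g -> fglift f g = 0.
Proof.
case=> flin fcomm; elim=> [|a g1 g2 _ h1 _ h2|w1 w2 d a u v|w1 w2 x y hc].
- by rewrite -(subrr 0) fglift_zmod subrr.
- by rewrite fgliftD fgliftZ h1 h2 scaler0 addr0.
- by rewrite fglift_zmod fgliftD fgliftZ !fglift_gen flin subrr.
- by rewrite fglift_zmod fgliftZ !fglift_gen fcomm ?subrr.
Qed.

Lemma wlift_pi c (M : lmodType K) (f : seq letter -> M) g :
  compat c f -> wlift f (wpi c g) = fglift f g.
Proof.
move=> fc; apply/eqP; rewrite -subr_eq0 -fglift_zmod; apply/eqP.
exact: fglift_wrel fc (wpi_repr c g).
Qed.

Lemma wlift_linear c (M : lmodType K) (f : seq letter -> M) :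
  compat c f -> linear (@wlift c M f).
Proof.
move=> fc a x y; rewrite -[x]wreprK -[y]wreprK -linearP !wlift_pi //.
by rewrite fgliftD fgliftZ.
Qed.

Lemma wliftE c (M : lmodType K) (f : seq letter -> M) w :
  compat c f -> wlift f (word c w) = f w.
Proof. by move=> fc; rewrite wlift_pi // fglift_gen. Qed.

Lemma word_lin c w1 w2 d a (u v : V d) :
  word c (w1 ++ mklet (a *: u + v) :: w2)
  = a *: word c (w1 ++ mklet u :: w2) + word c (w1 ++ mklet v :: w2).
Proof.
by rewrite /word -linearP; apply/wpi_eq/wrel_lin.
Qed.

Lemma word_comm (c : bool) w1 w2 x y : c ->
  word c (w1 ++ x :: y :: w2)
  = (-1) ^ (ldeg x * ldeg y) *: word c (w1 ++ y :: x :: w2).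
Proof. by move=> hc; rewrite /word -linearZ; apply/wpi_eq/wrel_comm. Qed.

Lemma walg_ind c (P : walg c -> Prop) :
  P 0 -> (forall a x y, P x -> P y -> P (a *: x + y)) ->
  (forall w, P (word c w)) -> forall x, P x.
Proof.
move=> P0 PP Pw x; rewrite -[x]wreprK -[wrepr x]freeg_sumE raddf_sum /=.
apply: (big_ind P) => // [y z Py Pz|w _].
  by rewrite -[y]scale1r; apply: PP.
suff -> : << coeff w (wrepr x) *g w >> = coeff w (wrepr x) *: fgen w.
  by rewrite linearZ /= -[X in P X]addr0; apply: PP => //; apply: Pw.
apply/eqP/freeg_eqP => v.
by rewrite coeffZ !coeffU mul1r.
Qed.

Lemma linear_fun0 (M N : lmodType K) (f : M -> N) : linear f -> f 0 = 0.
Proof.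
by move=> fl; have := fl (-1) 0 0; rewrite scaler0 addr0 scaleN1r addNr.
Qed.

Definition wmul c (x y : walg c) : walg c :=
  wlift (fun w1 => wlift (fun w2 => word c (w1 ++ w2)) y) x.

Fact compat_cat c w1 : compat c (fun w2 => word c (w1 ++ w2)).
Proof.
split=> [v1 v2 d a u v|hc v1 v2 x y]; rewrite !catA.
  exact: word_lin.
exact: word_comm.
Qed.

Fact wmul_cat c w1 w2 : wmul (word c w1) (word c w2) = word c (w1 ++ w2).
Proof.
have catl : forall v, wlift (fun v2 => word c (v ++ v2)) (word c w2)
    = word c (v ++ w2) by move=> v; rewrite wliftE //; apply: compat_cat.
rewrite /wmul wliftE ?catl //.
split=> [v1 v2 d a u v|hc v1 v2 x y]; rewrite !catl -!catA !cat_cons.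
  exact: word_lin.
exact: word_comm.
Qed.

Fact compat_wmulr c (y : walg c) :
  compat c (fun w1 => wlift (fun w2 => word c (w1 ++ w2)) y).
Proof.
have lin w1 := @wlift_linear c (walg c) _ (compat_cat c w1).
split=> [v1 v2 d a u v|hc v1 v2 x z].
- elim/walg_ind: y => [|b x y hx hy|w].
  + by rewrite !(linear_fun0 (lin _)) scaler0 addr0.
  + rewrite !lin hx hy !scalerDr !scalerA addrACA [b * a]mulrC.
    by [].
  + rewrite !wliftE -?catA /=; try exact: compat_cat.
    exact: word_lin.
- elim/walg_ind: y => [|b x' y hx hy|w].
  + by rewrite !(linear_fun0 (lin _)) scaler0.
  + by rewrite !lin hx hy !scalerDr !scalerA mulrC.
  + rewrite !wliftE -?catA /=; try exact: compat_cat.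
    exact: word_comm.
Qed.

Fact wmul_linl c (y : walg c) : linear (fun x => wmul x y).
Proof. exact: (wlift_linear (compat_wmulr y)). Qed.

Fact wmul_linr c (x : walg c) : linear (wmul x).
Proof.
move=> a y z; elim/walg_ind: x => [|b x x' hx hx'|w].
- have w0 t := linear_fun0 (wmul_linl t).
  by rewrite !w0 scaler0 addr0.
- by rewrite !wmul_linl hx hx' !scalerDr !scalerA addrACA [b * a]mulrC.
have lin t : wmul (word c w) t = wlift (fun w2 => word c (w ++ w2)) t.
  by rewrite /wmul wliftE //; apply: compat_wmulr.
by rewrite !lin (wlift_linear (compat_cat c w)).
Qed.

Fact wmul0l c (y : walg c) : wmul 0 y = 0.
Proof. exact: linear_fun0 (wmul_linl y). Qed.

Fact wmul0r c (x : walg c) : wmul x 0 = 0.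
Proof. exact: linear_fun0 (wmul_linr x). Qed.

Fact wmulA c : associative (@wmul c).
Proof.
move=> x y z; elim/walg_ind: x => [|a x x' hx hx'|u].
- by rewrite !wmul0l.
- by rewrite !wmul_linl hx hx'.
elim/walg_ind: y => [|a y y' hy hy'|v].
- by rewrite !(wmul0l, wmul0r).
- by rewrite !(wmul_linl, wmul_linr) hy hy'.
elim/walg_ind: z => [|a z z' hz hz'|w].
- by rewrite !wmul0r.
- by rewrite !wmul_linr hz hz'.
by rewrite !wmul_cat catA.
Qed.

Fact wmul1l c : left_id (word c [::]) (@wmul c).
Proof.
elim/walg_ind=> [|a x y hx hy|w]; first by rewrite wmul0r.
  by rewrite wmul_linr hx hy.
by rewrite wmul_cat.
Qed.

Fact wmul1r c : right_id (word c [::]) (@wmul c).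
Proof.
elim/walg_ind=> [|a x y hx hy|w]; first by rewrite wmul0l.
  by rewrite wmul_linl hx hy.
by rewrite wmul_cat cats0.
Qed.

Fact wmulDl c : left_distributive (@wmul c) +%R.
Proof. by move=> x y z; have := wmul_linl z 1 x y; rewrite !scale1r. Qed.

Fact wmulDr c : right_distributive (@wmul c) +%R.
Proof. by move=> x y z; have := wmul_linr x 1 y z; rewrite !scale1r. Qed.

Fact compat_aug c : compat c (fun w => (w == [::])%:R : K^o).
Proof.
split=> [w1 w2 d a u v|hc w1 w2 x y]; case: w1 => [|z w1] /=;
  by rewrite !(mulr0n, addr0, scaler0).
Qed.

Fact walg_oner_neq0 c : word c [::] != 0.
Proof.
apply/eqP=> h.
have := congr1 (wlift (fun w => (w == [::])%:R : K^o)) h.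
rewrite wliftE; last exact: compat_aug.
rewrite (linear_fun0 (wlift_linear (compat_aug c))) eqxx mulr1n => /eqP.
by rewrite oner_eq0.
Qed.

HB.instance Definition _ c :=
  GRing.Zmodule_isNzRing.Build (walg c)
    (@wmulA c) (@wmul1l c) (@wmul1r c) (@wmulDl c) (@wmulDr c)
    (@walg_oner_neq0 c).

Fact wscaleAl c a (x y : walg c) : a *: (x * y) = (a *: x) * y.
Proof.
by have h := wmul_linl y a x 0; rewrite !addr0 wmul0l addr0 in h; exact: esym h.
Qed.

Fact wscaleAr c a (x y : walg c) : a *: (x * y) = x * (a *: y).
Proof.
by have h := wmul_linr x a y 0; rewrite !addr0 wmul0r addr0 in h; exact: esym h.
Qed.

HB.instance Definition _ c :=
  GRing.Lmodule_isLalgebra.Build K (walg c) (@wscaleAl c).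
HB.instance Definition _ c :=
  GRing.Lalgebra_isAlgebra.Build K (walg c) (@wscaleAr c).

Lemma word_cat c w1 w2 : word c (w1 ++ w2) = word c w1 * word c w2.
Proof. by rewrite -wmul_cat. Qed.

(* The projection onto the span of the words satisfying P, when P depends     *)
(* only on the multiset of the degrees of the letters.                        *)
Definition wproj c (P : pred (seq letter)) : walg c -> walg c :=
  wlift (fun w => if P w then word c w else 0).

Definition lproj c (n : nat) : walg c -> walg c :=
  wproj (fun w => size w == n).

Definition dproj c (d : int) : walg c -> walg c :=
  wproj (fun w => wdeg w == d).

Lemma wdeg_cat w1 w2 : wdeg (w1 ++ w2) = wdeg w1 + wdeg w2.
Proof. by rewrite /wdeg big_cat. Qed.

Lemma wdeg_cons x w : wdeg (x :: w) = ldeg x + wdeg w.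
Proof. by rewrite /wdeg big_cons. Qed.

Fact compat_lproj c n :
  compat c (fun w => if size w == n then word c w else 0).
Proof.
split=> [w1 w2 d a u v|hc w1 w2 x y]; rewrite !size_cat /=;
  case: ifP => _; rewrite ?scaler0 ?addr0 //.
  exact: word_lin.
exact: word_comm.
Qed.

Fact compat_dproj c e :
  compat c (fun w => if wdeg w == e then word c w else 0).
Proof.
split=> [w1 w2 d a u v|hc w1 w2 x y]; rewrite !wdeg_cat !wdeg_cons.
  by case: ifP => _; rewrite ?scaler0 ?addr0 // word_lin.
rewrite [ldeg y + (ldeg x + _)]addrCA.
by case: ifP => _; rewrite ?scaler0 ?addr0 // word_comm.
Qed.

HB.instance Definition _ c n :=
  GRing.isLinear.Build K _ _ _ (@lproj c n) (wlift_linear (compat_lproj c n)).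
HB.instance Definition _ c d :=
  GRing.isLinear.Build K _ _ _ (@dproj c d) (wlift_linear (compat_dproj c d)).

Definition lcomp c (n : nat) : {pred walg c} := fun x => lproj n x == x.
Definition dcomp c (d : int) : {pred walg c} := fun x => dproj d x == x.

Fact dcomp_submod_closed c d : submod_closed (@dcomp c d).
Proof.
have dP x : (x \in dcomp d) = (dproj d x == x) by [].
split=> [|a x y]; rewrite !dP ?linear0 // => /eqP hx /eqP hy.
by rewrite linearP /= hx hy.
Qed.

HB.instance Definition _ c d :=
  GRing.isSubmodClosed.Build K _ (@dcomp c d) (@dcomp_submod_closed c d).

Lemma word_dcomp c w : word c w \in dcomp (wdeg w).
Proof.
by rewrite unfold_in /dproj /wproj wliftE ?eqxx //; apply: compat_dproj.
Qed.

End Letters.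

(* T(V) and S(V). *)
Definition TensAlg (K : fieldType) (V : int -> lmodType K) := walg V false.
Definition SymAlg (K : fieldType) (V : int -> lmodType K) := walg V true.

Section Unshuffles.
Variables (K : fieldType) (V : int -> lmodType K) (n : nat).
Implicit Types (x : 'I_n -> letter V) (s : 'S_n).

Definition perm_word x s : seq (letter V) := [seq x (s k) | k <- enum 'I_n].

(* The sign for which x_1 ... x_n = +/- x_s(1) ... x_s(n) in S(V). *)
Definition koszul_sign x s : K :=
  \prod_(k < n) \prod_(l < n | (k < l)%N && (s l < s k)%N)
    (-1) ^ (ldeg (x (s k)) * ldeg (x (s l))).

(* With indices from 0: s is increasing on [0, i[ and on [i, n[. *)
Definition unshuffle (i : nat) s : bool :=
  [forall k : 'I_n, forall l : 'I_n,
     (k < l)%N && ((l < i)%N || (i <= k)%N) ==> (s k < s l)%N].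

End Unshuffles.

Section KoszulCobrackets.
Variables (K : fieldType) (C : int -> lmodType K).
(* cop is the coproduct of C, with values in the words of length 2 of T(C);   *)
(* delta is an endomorphism of C of degree p, with values in C = S^1(C).      *)
Variable cop : letter C -> TensAlg C.
Variables (p : int) (delta : letter C -> SymAlg C).

(* iter_cop n is the iterated coproduct C -> T^(n+1)(C). *)
Fixpoint iter_cop (n : nat) (x : letter C) : TensAlg C :=
  if n is n'.+1 then
    wlift (fun w => if w is y :: w' then cop y * word false w' else 0)
      (iter_cop n' x)
  else word false [:: x].

Definition tens_sym : TensAlg C -> SymAlg C := wlift (fun w => word true w).

(* The completed symmetric algebra, as a set of sequences of components. *)
Definition Shat : set (nat -> SymAlg C) :=
  [set f | forall n, f n \in @lcomp K C true n].

Definition hat1 : nat -> SymAlg C := fun n => (n == 0%N)%:R.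

Definition hat_mul (f g : nat -> SymAlg C) : nat -> SymAlg C :=
  fun n => \sum_(i < n.+1) f i * g (n - i)%N.

Definition hat_letter (x : letter C) : nat -> SymAlg C :=
  fun n => if n == 1%N then word true [:: x] else 0.

Definition Eco_letter (x : letter C) : nat -> SymAlg C :=
  fun n => if n is n'.+1 then (n`!%:R)^-1 *: tens_sym (iter_cop n' x) else 0.

Definition Eco_word (w : seq (letter C)) : nat -> SymAlg C :=
  foldr (fun x f => hat_mul (Eco_letter x) f) hat1 w.

(* E^co of a word of length k has no component of length n < k, so that the   *)
(* multiplicative extension to the completion is a finite sum in each degree. *)
Definition Eco (f : nat -> SymAlg C) : nat -> SymAlg C :=
  fun n => \sum_(k < n.+1) wlift (fun w => Eco_word w n) (f k).

Definition Lco (g : nat -> SymAlg C) : nat -> SymAlg C :=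
  xget (fun=> 0) [set f | Shat f /\ Eco f = g].

Definition der_word (w : seq (letter C)) : SymAlg C :=
  \sum_(i < size w)
    (-1) ^ (p * wdeg (take i w))
    *: (word true (take i w) * delta (tnth (in_tuple w) i)
        * word true (drop i.+1 w)).

Definition der (f : nat -> SymAlg C) : nat -> SymAlg C :=
  fun n => wlift der_word (f n).

Definition koszul_cobracket (n : nat) (x : letter C) : SymAlg C :=
  Eco (der (Lco (hat_letter x))) n.

End KoszulCobrackets.

Section SymmetricCoalgebra.
Variables (K : fieldType) (U : int -> lmodType K).

(* The degree d component of S(U); thus a letter (gsym U) is a homogeneous    *)
(* element of S(U).                                                           *)
Record sdeg (d : int) : Type :=
  SDeg { sdeg_val :> SymAlg U; _ : sdeg_val \in dcomp d }.

HB.instance Definition _ d := [isSub for @sdeg_val d].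
HB.instance Definition _ d := [Choice of sdeg d by <:].
HB.instance Definition _ d := [SubChoice_isSubZmodule of sdeg d by <:].
HB.instance Definition _ d := [SubZmodule_isSubLmodule of sdeg d by <:].

Definition gsym : int -> lmodType K := fun d => sdeg d.

Definition lval (a : letter gsym) : SymAlg U := sdeg_val (tagged a).

Definition wlet (w : seq (letter U)) : letter gsym :=
  mklet (V := gsym) (SDeg (word_dcomp true w)).

(* The inclusion of C = S(U) in S(C). *)
Definition sym_inj : SymAlg U -> SymAlg gsym := wlift (fun w => word true [:: wlet w]).

Definition lle (m : nat) : {pred SymAlg U} :=
  fun x => \sum_(j < m.+1) lproj j x == x.

Definition counit : SymAlg U -> K := wlift (M := K^o) (fun w => (w == [::])%:R).

Definition antipode : SymAlg U -> SymAlg U :=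
  wlift (fun w => (-1) ^+ size w *: word true w).

Definition cop_word (n : nat) (x : 'I_n -> letter U) : TensAlg gsym :=
  \sum_(i < n.+1) \sum_(s : 'S_n | unshuffle i s)
    koszul_sign x s *: word false [:: wlet (take i (perm_word x s));
                                      wlet (drop i (perm_word x s))].

(* The unshuffle coproduct, with values in the words of length 2 of T(S(U)). *)
Definition cop : SymAlg U -> TensAlg gsym :=
  wlift (fun w => cop_word (tnth (in_tuple w))).

(* Convolution product, q being the degree of G. *)
Definition conv (q : int) (F G : SymAlg U -> SymAlg U) (x : SymAlg U) : SymAlg U :=
  wlift (fun w => if w is [:: a; b]
                 then (-1) ^ (q * ldeg a) *: (F (lval a) * G (lval b)) else 0)
    (cop x).

(* The Koszul bracket K(D)_n on homogeneous arguments, which determine it by  *)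
(* multilinearity.                                                            *)
Definition koszul_bracket (D : SymAlg U -> SymAlg U) (n : nat)
    (a : 'I_n -> letter gsym) : SymAlg U :=
  \sum_(1 <= i < n.+1) \sum_(s : 'S_n | unshuffle i s)
    (koszul_sign a s * (-1) ^+ (n - i))
    *: (D (\prod_(x <- take i (perm_word a s)) lval x)
        * \prod_(x <- drop i (perm_word a s)) lval x).

Definition has_degree (p : int) (f : SymAlg U -> SymAlg U) : Prop :=
  forall d x, x \in dcomp d -> f x \in dcomp (d + p).

Definition End_cu (f : SymAlg U -> SymAlg U) : Prop :=
  (forall x, counit (f x) = 0) /\ f 1 = 0.

Definition sym_cobracket (p : int) (f : SymAlg U -> SymAlg U) (n : nat)
    (x : letter gsym) : SymAlg gsym :=
  koszul_cobracket (fun y => cop (lval y)) p (fun y => sym_inj (f (lval y))) n x.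

(* A K[[t]]-linear endomorphism of S(U)[[t]] is given by the sequence of its  *)
(* coefficients delta n : S(U) -> S(U); tser_app is its action on S(U)[[t]].  *)
Definition tser_app (delta : nat -> SymAlg U -> SymAlg U) (y : nat -> SymAlg U) :
    nat -> SymAlg U :=
  fun n => \sum_(i < n.+1) delta i (y (n - i)%N).

(* As t has degree 2, delta has degree 1 when delta n has degree 1 - 2n. *)
Definition tser_degree1 (delta : nat -> SymAlg U -> SymAlg U) : Prop :=
  forall n, has_degree (1 - 2 * n%:Z) (delta n).

Definition tser_square0 (delta : nat -> SymAlg U -> SymAlg U) : Prop :=
  forall y, tser_app delta (tser_app delta y) = fun=> 0.

Definition eq0_mod_t (M : zmodType) (m : nat) (f : nat -> M) : Prop :=
  forall n, (n < m)%N -> f n = 0.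

Definition IBL_infty1 (delta : nat -> SymAlg U -> SymAlg U) : Prop :=
  [/\ tser_degree1 delta, forall n, End_cu (delta n), tser_square0 delta
    & forall m x, (2 <= m)%N ->
        eq0_mod_t m.-1
          (fun n => sym_cobracket (1 - 2 * n%:Z) (delta n) m x)].

Definition tser_conv_antipode (delta : nat -> SymAlg U -> SymAlg U) :
    nat -> SymAlg U -> SymAlg U :=
  fun n => conv 0 (delta n) antipode.

End SymmetricCoalgebra.

(* Main.v *)
(* Everything reduces to identities between sums over the splittings of a word *)
(* of letters of U into two complementary subwords (unsh); one delta_n, called *)
(* D, is considered at a time, and phi = D * s, so that D = phi * id.          *)
(*                                                                             *)
(* Brackets.  K(D)_k(x_1, ..., x_k) is the iterated graded commutator of D     *)
(* with the multiplications by the x_i, evaluated at 1; on letters it is phi.  *)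
(* The bound on phi spreads to all arguments because                           *)
(*   [D, L_xy] = [[D, L_x], L_y] +/- L_y [D, L_x] +/- L_x [D, L_y].            *)
(*                                                                             *)
(* Cobrackets.  With iota : S(U) -> S(S(U)) the inclusion and iota^i its       *)
(* convolution powers, E^co = exp(iota) - 1 and L^co = log(1 + iota), whence   *)
(*   K^co(D)_n = sum_(i + j = n) (-1)^j / (i! j!) (iota^i o D) * iota^j.       *)
(* The projection S(U) -> U induces S(S(U)) -> S(U), which maps iota^i / i! to *)
(* the projection onto S^i(U) and hence K^co(D)_n to the length n component of *)
(* phi.  Conversely, iota^i(v w) is, for a fixed word v, a sum over q <= |v|   *)
(* of i(i-1)...(i-q+1) (Q_q * iota^(i-q))(w), and the alternating binomial     *)
(* sums of these falling factorials vanish when q < n; as D = phi * id, the    *)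
(* cobracket K^co(D)_n vanishes as soon as the values of phi have length < n.  *)

(* For each n the four conditions concern the single operator D = [delta n] and the bound m = n + 1,
   and each is compared with the statement that all values of phi = [convs D] lie in [lle m].
   Condition b is this statement up to linearity ([conv_antipode_lle]), and c says the same because
   the brackets on letters of U are the values of phi on nonempty words ([convs_lle_letters]). For
   d, taking an argument y of length at most i into account replaces D by [D, L_y] and raises the
   bound on phi by i - 1 ([convs_gcomm]). Peeling off the arguments one by one gives [kbracket_lle];
   all lengths equal to 1 give back c.

   For a, the maps involved are built from convolution powers of iota, so that E^co and L^co act
   through power series in one variable ([Theta_ipow]), and the cobracket is the component of order
   n of ((exp(iota) - 1) o D) * exp(-iota) ([sym_cobracketE]). Its image in S(U) is the length n
   component of phi ([lproj_convs]), so a implies b. The converse is [cobracket_term_eq0]: after the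
   substitution D = phi * id the cobracket is an n-th finite difference of polynomials of degree
   less than n. *)
From HB Require Import structures.
Require Import Defs.
From mathcomp Require Import all_boot all_order perm all_algebra.
From mathcomp Require Import boolp classical_sets.
From mathcomp Require Import zify ring.

Set Implicit Arguments.
Unset Strict Implicit.
Unset Printing Implicit Defensive.

Import GRing.Theory.
Local Open Scope ring_scope.

(** * Unshuffles *)

Section Unshuffles.
Variables (K : fieldType) (V : int -> lmodType K).
Implicit Types (w : seq (letter V)) (M : lmodType K).

(** The unshuffle coproduct of w paired with F. A letter sent to the right factor has to pass the
    whole left factor, whence the sign. Recursion on the word replaces sums over permutations in all
    later inductions. *)
Fixpoint unsh M (F : seq (letter V) -> seq (letter V) -> M) w : M :=
  if w is x :: w' then
    unsh (fun a b => F (x :: a) b) w'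
    + unsh (fun a b => (-1) ^ (ldeg x * wdeg a) *: F a (x :: b)) w'
  else F [::] [::].

(** A permutation of n + 1 indices amounts to the position j of the index 0 and a permutation of the
    remaining ones. *)
Lemma sum_lift_perm (M : nmodType) n (P : pred 'S_n.+1) (F : 'S_n.+1 -> M) :
  \sum_(s | P s) F s
  = \sum_(j < n.+1) \sum_(s : 'S_n | P (lift_perm j ord0 s)) F (lift_perm j ord0 s).
Proof.
rewrite pair_big_dep /= (reindex (fun t : 'I_n.+1 * 'S_n => lift_perm t.1 ord0 t.2)) //.
apply/onW_bij/inj_card_bij; last by rewrite card_prod card_ord !card_Sn factS.
move=> [j s] [j' s'] /= e.
have ej : j = j'.
  by apply: (@perm_inj _ (lift_perm j ord0 s)); rewrite {2}e !lift_perm_id.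
move: e; rewrite -{j'}ej => e; congr (_, _); apply/permP => k.
by apply: (@lift_inj _ ord0); rewrite -!(lift_perm_lift j ord0) e.
Qed.

(** The index 0 is the least one, so in an unshuffle it heads one of the two increasing blocks: its
    position is 0 or i. *)
Lemma unshuffle_lift n i (j : 'I_n.+1) (s : 'S_n) :
  unshuffle i (lift_perm j ord0 s)
  = (0 < i)%N && (j == ord0) && unshuffle i.-1 s || (j == i :> nat) && unshuffle i s.
Proof.
apply/idP/idP => [/forallP h|].
- have {}h (k l : 'I_n.+1) : (k < l)%N -> (l < i)%N || (i <= k)%N ->
      (lift_perm j ord0 s k < lift_perm j ord0 s l)%N.
    by move=> kl bl; have /forallP/(_ l) := h k; rewrite kl bl.
  have hs (c : nat) (H : forall k l : 'I_n, (k < l)%N -> 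
      (l < c)%N || (c <= k)%N -> (bump j l < i)%N || (i <= bump j k)%N) :
      unshuffle c s.
    apply/forallP=> k; apply/forallP => l; apply/implyP => /andP[kl bl].
    have := h (lift j k) (lift j l).
    rewrite !lift_perm_lift /= /bump leq0n !add1n ltnS.
    apply; last exact: H.
    by lia.
  case: (posnP (nat_of_ord j)) => [j0|jgt0].
    have -> : j == ord0 by apply/eqP/val_inj.
    case: (posnP i) => [i0|i0].
      by rewrite j0 /= eq_sym i0 /= hs // => k l; rewrite /bump; lia.
    by rewrite /= hs //= => k l; rewrite /bump; lia.
  case: (eqVneq (nat_of_ord j) i) => [ji|ji] /=.
    by rewrite (hs i) ?orbT // => k l; rewrite -ji /bump; lia.
  have [ji'|ji'] : (j < i)%N \/ (i < j)%N by move: ji => /=; lia.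
    by have := h ord0 j jgt0; rewrite lift_perm_id ji' ltn0; move/(_ isT).
  have iN : (i < n.+1)%N by have := ltn_ord j; lia.
  have := h (Ordinal iN) j ji'; rewrite lift_perm_id ltn0 leqnn orbT.
  by move/(_ isT).
- move=> h; apply/forallP=> k; apply/forallP => l; apply/implyP => /andP[kl bl].
  move: h kl bl.
  case: (unliftP j l) => [l'|] ->; case: (unliftP j k) => [k'|] ->; 
    rewrite ?lift_perm_lift ?lift_perm_id ?ltnn //=.
    move=> h kl bl; rewrite /bump !leq0n !add1n ltnS.
    have {}kl : (k' < l')%N by move: kl; rewrite /= /bump; lia.
    case/orP: h => [/andP[/andP[i0 /eqP j0]]|/andP[/eqP ji]];
      move/forallP/(_ k')/forallP/(_ l')/implyP; apply; rewrite kl /=;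
      move: bl; rewrite ?j0 /bump /=; lia.
  move=> h kl bl; exfalso; move: h kl bl; rewrite -[j == ord0]val_eqE /= /bump.
  by case: (unshuffle _ _); case: (unshuffle _ _); lia.
Qed.

Lemma perm_word_lift n (x : 'I_n.+1 -> letter V) (j : 'I_n.+1) (s : 'S_n) :
  perm_word x (lift_perm j ord0 s)
  = take j (perm_word (x \o lift ord0) s)
    ++ x ord0 :: drop j (perm_word (x \o lift ord0) s).
Proof.
have sz m (y : 'I_m -> letter V) (t : 'S_m) : size (perm_word y t) = m.
  by rewrite size_map size_enum_ord.
have nthpw m (y : 'I_m -> letter V) (t : 'S_m) k (km : (k < m)%N) :
    nth (x ord0) (perm_word y t) k = y (t (Ordinal km)).
  rewrite (nth_map (Ordinal km)) ?size_enum_ord //; congr (y (t _)).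
  by apply: val_inj; rewrite /= nth_enum_ord.
have jn := ltn_ord j.
apply: (@eq_from_nth _ (x ord0)) => [|k].
  rewrite size_cat /= size_drop !sz size_take sz.
  by case: ltnP; lia.
rewrite sz => kn; rewrite nthpw nth_cat size_takel ?sz //.
case: ltnP => kj.
  have kn' : (k < n)%N by lia.
  rewrite nth_take // nthpw /=; congr x.
  rewrite (_ : Ordinal kn = lift j (Ordinal kn')) ?lift_perm_lift //.
  by apply: val_inj; rewrite /= /bump; lia.
case: (eqVneq k j) => [kj'|nkj].
  have -> : Ordinal kn = j by apply: val_inj.
  by rewrite lift_perm_id [X in nth _ _ X](_ : _ = 0%N) // kj' subnn.
have kn' : (k.-1 < n)%N by move: nkj kj; lia.
have -> : (k - j = (k.-1 - j).+1)%N by move: nkj kj; lia.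
rewrite /= nth_drop (_ : (j + (k.-1 - j) = k.-1)%N); last by move: nkj kj; lia.
rewrite nthpw /=; congr x.
rewrite (_ : Ordinal kn = lift j (Ordinal kn')) ?lift_perm_lift //.
by apply: val_inj; rewrite /= /bump; move: nkj kj; lia.
Qed.

(** The inversions that involve the index 0 are those with the j letters placed before it; the
    others are inversions of s. *)
Lemma koszul_sign_lift n (x : 'I_n.+1 -> letter V) (j : 'I_n.+1) (s : 'S_n) :
  koszul_sign x (lift_perm j ord0 s)
  = (-1) ^ (ldeg (x ord0) * wdeg (take j (perm_word (x \o lift ord0) s)))
    * koszul_sign (x \o lift ord0) s :> K.
Proof.
have sgn (k : 'I_n) : \prod_(l : 'I_n.+1 | (lift j k < l)%N && 
      (lift_perm j ord0 s l < lift_perm j ord0 s (lift j k))%N)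
      (-1) ^ (ldeg (x (lift_perm j ord0 s (lift j k))) * 
              ldeg (x (lift_perm j ord0 s l)))
    = (if (k < j)%N then (-1) ^ (ldeg (x ord0) * ldeg ((x \o lift ord0) (s k)))
      else 1) *
      \prod_(l : 'I_n | (k < l)%N && (s l < s k)%N)
         (-1) ^ (ldeg ((x \o lift ord0) (s k)) * ldeg ((x \o lift ord0) (s l)))
      :> K.
  rewrite big_mkcond (bigD1_ord j) //= lift_perm_id lift_perm_lift lift0 /=.
  congr (_ * _).
    rewrite /= /bump ltn0Sn andbT [ldeg (x ord0) * _]mulrC.
    by congr (if _ then _ else _); lia.
  rewrite [RHS]big_mkcond; apply: eq_bigr => l _; rewrite lift_perm_lift lift0 /=.
  rewrite /bump.
  by congr (if _ then _ else _); congr (_ && _); lia.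
rewrite /koszul_sign (bigD1_ord j) //= big_pred0 ?mul1r; last first.
  by move=> l; rewrite lift_perm_id ltn0 andbF.
rewrite (eq_bigr _ (fun k _ => sgn k)) big_split /=; congr (_ * _).
rewrite -big_mkcond /=.
have -> : take j (perm_word (x \o lift ord0) s)
   = [seq (x \o lift ord0) (s k) | k : 'I_n <- enum 'I_n & (k < j)%N].
  rewrite /perm_word -map_take; congr map.
  apply: (inj_map val_inj); rewrite map_take val_enum_ord.
  rewrite -(filter_map _ (fun k => (k < j)%N)) val_enum_ord take_iota.
  have jn : (j <= n)%N by rewrite -ltnS.
  rewrite (minn_idPl jn); apply: (@sorted_eq _ ltn).
  - exact: ltn_trans.
  - by move=> a b /andP[]; lia.
  - exact: iota_ltn_sorted.
  - by apply: sorted_filter; [exact: ltn_trans|exact: iota_ltn_sorted].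
  - apply: uniq_perm; rewrite ?filter_uniq ?iota_uniq // => k.
    by rewrite mem_filter !mem_iota /=; lia.
rewrite /wdeg big_map big_filter big_enum_cond /= mulr_sumr.
elim/big_rec2: _ => [|k a b _ ->]; first by rewrite expr0z.
by rewrite expfzDr // oppr_eq0 oner_eq0.
Qed.

Lemma sum_unshuffle M n (x : 'I_n -> letter V) F :
  \sum_(i < n.+1) \sum_(s : 'S_n | unshuffle i s)
     koszul_sign x s *: F (take i (perm_word x s)) (drop i (perm_word x s))
  = unsh F [seq x k | k <- enum 'I_n] :> M.
Proof.
elim: n => [|n IH] in x F *.
  have e0 : enum 'I_0 = [::] by apply: size0nil; rewrite size_enum_ord.
  rewrite big_ord1 e0 /= (big_pred1 (1%g : 'S_0)) => [|s]; last first.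
    by rewrite (_ : unshuffle 0 s); [apply/esym/eqP/permP => - []|apply/forallP => - []].
  by rewrite /perm_word e0 /= /koszul_sign big_ord0 scale1r.
rewrite enum_ordSl /= -map_comp -!IH -big_split /=.
pose x' := x \o lift ord0.
pose G i s : M := koszul_sign x s *: F (take i (perm_word x s)) (drop i (perm_word x s)).
(* For i = n + 1 the second block is empty and cannot contain the index 0: [insub] fails and the
   second summand is 0. *)
have split_s (i : nat) : \sum_(s : 'S_n.+1 | unshuffle i s) G i s
    = (if (0 < i)%N then \sum_(s : 'S_n | unshuffle i.-1 s) G i (lift_perm ord0 ord0 s)
       else 0)
      + (if insub i is Some j then 
          \sum_(s : 'S_n | unshuffle i s) G i (lift_perm j ord0 s) else 0).
  rewrite sum_lift_perm.
  case: (posnP i) => [->|i0].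
    rewrite add0r insubT /=.
    rewrite (bigD1 (Ordinal (ltn0Sn n))) //= [X in _ + X]big1 ?addr0.
      rewrite (_ : Sub _ _ = Ordinal (ltn0Sn n)); last exact: val_inj.
      by apply: eq_bigl => s; rewrite unshuffle_lift.
    move=> j j0; rewrite big_pred0 // => s; rewrite unshuffle_lift /=.
    by rewrite (_ : (j == 0 :> nat) = false) //; apply: contraNF j0.
  rewrite (bigD1 ord0) //=; congr (_ + _).
    apply: eq_bigl => s; rewrite unshuffle_lift i0 eqxx /= -[0 == i]/(0%N == i).
    by rewrite (_ : (0%N == i) = false) ?orbF //; lia.
  case: insubP => [j _ ji|ni].
    rewrite (bigD1 j) /=; last by rewrite -val_eqE /= ji; lia.
    rewrite [X in _ + X]big1 ?addr0 => [|k /andP[k0 kj]].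
      apply: eq_bigl => s; rewrite unshuffle_lift ji eqxx /=.
      by rewrite -val_eqE /= ji (_ : (i == 0)%N = false) ?andbF //; lia.
    rewrite big_pred0 // => s; rewrite unshuffle_lift (negPf k0) andbF /=.
    by rewrite -ji val_eqE (negPf kj).
  rewrite big1 // => k k0; rewrite big_pred0 // => s.
  rewrite unshuffle_lift (negPf k0) andbF /=.
  by case: eqP => // ki; move: ni; rewrite -ki ltn_ord.
rewrite -/G; under eq_bigr do rewrite split_s.
rewrite big_split /= [X in X + _]big_ord_recl [X in _ + X]big_ord_recr /= add0r.
rewrite insubF ?ltnn // addr0 -big_split /=; apply: eq_bigr => i _.
congr (_ + _).
  apply: eq_bigr => s _; rewrite /G koszul_sign_lift perm_word_lift.
  by rewrite /= take0 drop0 /wdeg big_nil mulr0 expr0z mul1r.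
case: insubP => [j _ /= ji|]; last by rewrite /= ltn_ord.
have {j ji} -> : j = i by apply: val_inj.
apply: eq_bigr => s _; rewrite /G koszul_sign_lift perm_word_lift scalerA /=.
have szt : size (take i (perm_word x' s)) = i.
  by rewrite size_takel // size_map size_enum_ord -ltnS.
rewrite take_size_cat // drop_size_cat // mulrC.
by [].
Qed.

Lemma wdeg_nil : wdeg (Nil (letter V)) = 0.
Proof. by rewrite /wdeg big_nil. Qed.

Lemma sgnD (a b : int) : (-1) ^ (a + b) = (-1) ^ a * (-1) ^ b :> K.
Proof. by rewrite expfzDr // oppr_eq0 oner_eq0. Qed.

Lemma sgn_sqr (a : int) : (-1) ^ a * (-1) ^ a = 1 :> K.
Proof. by rewrite -expfzMl mulrNN mulr1 exp1rz. Qed.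

Lemma sgn_double (a : int) : (-1) ^ (2 * a) = 1 :> K.
Proof. by rewrite mulrDl !mul1r sgnD sgn_sqr. Qed.

Lemma eq_unsh_in M (F G : seq (letter V) -> seq (letter V) -> M) w :
  (forall a b, (size a + size b = size w)%N -> wdeg a + wdeg b = wdeg w ->
     F a b = G a b) -> unsh F w = unsh G w.
Proof.
elim: w F G => [|x w IH] F G FG /=.
  by apply: FG => //; rewrite wdeg_nil addr0.
congr (_ + _); apply: IH => a b sab dab.
  by rewrite FG // ?wdeg_cons -?addrA ?dab // /= addSn sab.
by rewrite FG // ?wdeg_cons 1?addrCA ?dab // /= addnS sab.
Qed.

Lemma eq_unsh M (F G : seq (letter V) -> seq (letter V) -> M) w :
  (forall a b, F a b = G a b) -> unsh F w = unsh G w.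
Proof. by move=> FG; apply: eq_unsh_in => a b _ _. Qed.

Lemma unsh0 M w : unsh (fun _ _ => 0 : M) w = 0.
Proof.
elim: w => //= x w IH; rewrite IH add0r -[RHS]IH.
by apply: eq_unsh => a b; rewrite scaler0.
Qed.

Lemma unshP M k (F G : seq (letter V) -> seq (letter V) -> M) w :
  unsh (fun a b => k *: F a b + G a b) w = k *: unsh F w + unsh G w.
Proof.
elim: w F G => //= x w IH F G; rewrite scalerDr addrACA -!IH; congr (_ + _).
by apply: eq_unsh => a b; rewrite scalerDr !scalerA mulrC.
Qed.

Lemma unshD M (F G : seq (letter V) -> seq (letter V) -> M) w :
  unsh (fun a b => F a b + G a b) w = unsh F w + unsh G w.
Proof.
rewrite -[unsh F w]scale1r -unshP; apply: eq_unsh => a b.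
by rewrite scale1r.
Qed.

Lemma unshZ M k (F : seq (letter V) -> seq (letter V) -> M) w :
  unsh (fun a b => k *: F a b) w = k *: unsh F w.
Proof.
rewrite -[RHS]addr0 -[X in _ + X](unsh0 _ w) -unshP; apply: eq_unsh => a b.
by rewrite addr0.
Qed.

Lemma unsh_sum M I (r : seq I) (P : pred I)
    (F : I -> seq (letter V) -> seq (letter V) -> M) w :
  unsh (fun a b => \sum_(i <- r | P i) F i a b) w
  = \sum_(i <- r | P i) unsh (F i) w.
Proof.
elim: r => [|i r IH].
  by rewrite big_nil -[RHS](unsh0 _ w); apply: eq_unsh => a b; rewrite big_nil.
rewrite big_cons -IH; case: ifP => Pi; last first.
  by apply: eq_unsh => a b; rewrite big_cons Pi.
by rewrite -unshD; apply: eq_unsh => a b; rewrite big_cons Pi.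
Qed.

Lemma unsh_linear M (N : lmodType K) (h : {linear M -> N})
    (F : seq (letter V) -> seq (letter V) -> M) w :
  h (unsh F w) = unsh (fun a b => h (F a b)) w.
Proof.
elim: w F => //= x w IH F; rewrite linearD !IH; congr (_ + _).
by apply: eq_unsh => a b; rewrite linearZ.
Qed.

Lemma unsh_mull (A : algType K) (y : A) (F : seq (letter V) -> seq (letter V) -> A) w :
  unsh (fun a b => y * F a b) w = y * unsh F w.
Proof.
elim: w F => //= x w IH F; rewrite mulrDr -!IH; congr (_ + _).
by apply: eq_unsh => a b; rewrite scalerAr.
Qed.

Lemma unsh_mulr (A : algType K) (y : A) (F : seq (letter V) -> seq (letter V) -> A) w :
  unsh (fun a b => F a b * y) w = unsh F w * y.
Proof.
elim: w F => //= x w IH F; rewrite mulrDl -!IH; congr (_ + _).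
by apply: eq_unsh => a b; rewrite scalerAl.
Qed.

Lemma unsh_closed_in M (S : submodClosed M)
    (F : seq (letter V) -> seq (letter V) -> M) w :
  (forall a b, wdeg a + wdeg b = wdeg w -> F a b \in S) -> unsh F w \in S.
Proof.
elim: w F => [|x w IH] F FS /=; first by apply: FS; rewrite wdeg_nil addr0.
apply: rpredD; apply: IH => a b dab.
  by apply: FS; rewrite !wdeg_cons -dab addrA.
by apply/rpredZ/FS; rewrite !wdeg_cons -dab addrCA.
Qed.

(** Coassociativity: both sides run over the splittings into three subwords. *)
Lemma unshA M (F : seq (letter V) -> seq (letter V) -> seq (letter V) -> M) w :
  unsh (fun a b => unsh (fun a1 a2 => F a1 a2 b) a) w
  = unsh (fun a b => unsh (fun b1 b2 => F a b1 b2) b) w.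
Proof.
elim: w F => //= x w IH F.
rewrite unshD IH -addrA; congr (_ + _).
rewrite (IH (fun a1 a2 b => (-1) ^ (ldeg x * wdeg a1) *: F a1 (x :: a2) b)).
rewrite -[in RHS](eq_unsh (F := fun a b =>
   (-1) ^ (ldeg x * wdeg a) *: unsh (fun b1 b2 => F a (x :: b1) b2) b +
   unsh (fun b1 b2 => (-1) ^ (ldeg x * wdeg a) *:
                      ((-1) ^ (ldeg x * wdeg b1) *: F a b1 (x :: b2))) b));
  last by move=> a b; rewrite unshZ -scalerDr.
rewrite unshD; congr (_ + _).
  by apply: eq_unsh => a b; rewrite unshZ.
rewrite -IH; apply: eq_unsh => a b; rewrite -unshZ.
apply: eq_unsh_in => a1 a2 _ <-.
by rewrite scalerA -sgnD mulrDr.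
Qed.

(** Graded cocommutativity. *)
Lemma unshC M (F : seq (letter V) -> seq (letter V) -> M) w :
  unsh F w = unsh (fun a b => (-1) ^ (wdeg a * wdeg b) *: F b a) w.
Proof.
elim: w F => [|x w IH] F /=; first by rewrite wdeg_nil mulr0 expr0z scale1r.
rewrite addrC; congr (_ + _); rewrite IH; apply: eq_unsh => a b.
  by rewrite scalerA -sgnD wdeg_cons mulrDl addrC.
by rewrite scalerA wdeg_cons mulrDr sgnD mulrA [wdeg a * ldeg x]mulrC sgn_sqr mul1r.
Qed.

Lemma unsh_nill M (F : seq (letter V) -> seq (letter V) -> M) w :
  unsh (fun a b => if a is [::] then F a b else 0) w = F [::] w.
Proof.
elim: w F => //= x w IH F; rewrite unsh0 add0r.
rewrite -[RHS](IH (fun a b => F a (x :: b))); apply: eq_unsh => - [|y a] b.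
  by rewrite wdeg_nil mulr0 expr0z scale1r.
by rewrite scaler0.
Qed.

Lemma unsh_nilr M (F : seq (letter V) -> seq (letter V) -> M) w :
  unsh (fun a b => if b is [::] then F a b else 0) w = F w [::].
Proof.
elim: w F => //= x w IH F; rewrite (IH (fun a b => F (x :: a) b)).
rewrite -[RHS]addr0; congr (_ + _).
by rewrite -[RHS](unsh0 M w); apply: eq_unsh => a b; rewrite scaler0.
Qed.

End Unshuffles.

(** * Words *)

Section WordAlgebras.
Variables (K : fieldType) (V : int -> lmodType K) (c : bool).
Implicit Types (w : seq (letter V)) (M N : lmodType K).

Definition wext M (f : seq (letter V) -> M) (fc : compat c f) : walg V c -> M :=
  wlift f.

HB.instance Definition _ M f fc :=
  GRing.isLinear.Build K _ _ _ (@wext M f fc) (wlift_linear fc).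

Lemma wextE M (f : seq (letter V) -> M) (fc : compat c f) w :
  wext fc (word c w) = f w.
Proof. exact: wliftE. Qed.

Lemma walg_linear_eq M (f g : {linear walg V c -> M}) :
  (forall w, f (word c w) = g (word c w)) -> f =1 g.
Proof.
move=> fg; elim/walg_ind=> [|a x y hx hy|w]; rewrite ?linear0 //.
by rewrite !linearP hx hy.
Qed.

Lemma compat_word : compat c (word (V := V) c).
Proof. by split=> *; [exact: word_lin|exact: word_comm]. Qed.

Lemma compat_linear M N (h : {linear M -> N}) (f : seq (letter V) -> M) :
  compat c f -> compat c (fun w => h (f w)).
Proof.
case=> fl fs; split=> [w1 w2 d a u v|hc w1 w2 x y]; first by rewrite fl linearP.
by rewrite fs // linearZ.
Qed.

Lemma compat_cons M (f : seq (letter V) -> M) x :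
  compat c f -> compat c (fun w => f (x :: w)).
Proof.
case=> fl fs; split=> [w1 w2 d a u v|hc w1 w2 y z].
  exact: (fl (x :: w1)).
exact: (fs hc (x :: w1)).
Qed.

Lemma compat_sgn M (f : seq (letter V) -> M) (d : int) :
  compat c f -> compat c (fun w => (-1) ^ (d * wdeg w) *: f w).
Proof.
case=> fl fs; split=> [w1 w2 e a u v|hc w1 w2 x y].
  rewrite fl scalerDr !scalerA ![_ * a]mulrC !wdeg_cat !wdeg_cons.
  by [].
rewrite fs // !scalerA; congr (_ *: _); rewrite [LHS]mulrC !wdeg_cat !wdeg_cons.
by rewrite [ldeg x + (_ + _)]addrCA.
Qed.

(** The coproduct descends to the quotient algebra, so convolutions of well-defined maps are well
    defined. *)
Lemma compat_unsh M (F : seq (letter V) -> seq (letter V) -> M) :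
  (forall b, compat c (F^~ b)) -> (forall a, compat c (F a)) ->
  compat c (unsh F).
Proof.
move=> Fl Fr; split=> [w1 w2 d a u v|hc w1 w2 x y].
  elim: w1 F Fl Fr => [|z w1 IH] F Fl Fr /=.
    have FlE A b := (Fl b).1 [::] A d a u v.
    have FrE A b := (Fr b).1 [::] A d a u v.
    rewrite scalerDr addrACA -!unshP; congr (_ + _); apply: eq_unsh => A b.
      exact: FlE.
    by rewrite [F _ _]FrE /= scalerDr !scalerA mulrC.
  rewrite !IH 1?scalerDr 1?addrACA // => [b|b|b].
  - exact/compat_sgn/Fl.
  - exact/compat_linear/compat_cons/Fr.
  - exact: (compat_cons z (Fl b)).
elim: w1 F Fl Fr => [|z w1 IH] F Fl Fr /=.
  have FlE A b := (Fl b).2 hc [::] A x y.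
  have FrE A b := (Fr b).2 hc [::] A x y.
  (* Four cases for the sides of x and y. The transposition exchanges the two mixed ones; the other
     two use the relation inside one argument of F. *)
  rewrite !scalerDr -!unshZ -!addrA; congr (_ + _).
    by apply: eq_unsh => A b; exact: FlE.
  rewrite addrCA; congr (_ + _).
    apply: eq_unsh => A b; rewrite wdeg_cons mulrDr sgnD -scalerA.
    by [].
  congr (_ + _); apply: eq_unsh => A b; rewrite ?wdeg_cons.
    by rewrite scalerA mulrDr sgnD mulrA [ldeg y * ldeg x]mulrC sgn_sqr mul1r.
  rewrite [F _ _]FrE !scalerA; congr (_ *: _).
  by ring.
rewrite !IH ?scalerDr // => b.
- exact/compat_sgn/Fl.
- exact/compat_linear/compat_cons/Fr.
- exact: (compat_cons z (Fl b)).
Qed.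

Lemma lproj_word n w : lproj n (word c w) = if size w == n then word c w else 0.
Proof. by rewrite /lproj /wproj wliftE //; apply: compat_lproj. Qed.

Lemma dproj_word d w : dproj d (word c w) = if wdeg w == d then word c w else 0.
Proof. by rewrite /dproj /wproj wliftE //; apply: compat_dproj. Qed.

Lemma lproj_lproj m n x :
  lproj m (lproj n x) = if m == n then lproj n x else 0 :> walg V c.
Proof.
elim/walg_ind: x => [|a x y hx hy|w].
- by rewrite !linear0; case: ifP.
- by rewrite !linearP /= hx hy; case: ifP; rewrite ?scaler0 ?addr0.
rewrite lproj_word; case: eqVneq => [<-|_]; last by rewrite linear0; case: ifP.
by rewrite lproj_word eq_sym; case: ifP.
Qed.

Lemma dproj_dcomp d (x : walg V c) : dproj d x \in dcomp d.
Proof.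
elim/walg_ind: x => [|a x y hx hy|w].
- by rewrite linear0 rpred0.
- rewrite linearP /=.
  by have h := (dcomp_submod_closed V c d).2 a _ _ hx hy; exact: h.
by rewrite dproj_word; case: eqP => [<-|_]; rewrite ?rpred0 ?word_dcomp.
Qed.

Lemma dproj_id d (x : walg V c) : x \in dcomp d -> dproj d x = x.
Proof. by move/eqP. Qed.

Lemma letter_dcomp (x : letter V) : word c [:: x] \in dcomp (ldeg x).
Proof. by have := word_dcomp c [:: x]; rewrite wdeg_cons wdeg_nil addr0. Qed.

Lemma dcomp_ind d (P : walg V c -> Prop) :
  P 0 -> (forall a x y, P x -> P y -> P (a *: x + y)) ->
  (forall w, wdeg w = d -> P (word c w)) -> forall x, x \in dcomp d -> P x.
Proof.
move=> P0 PP Pw x /dproj_id <-; elim/walg_ind: x => [|a x y hx hy|w].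
- by rewrite linear0.
- by rewrite linearP; apply: PP.
by rewrite dproj_word; case: eqP => // /Pw.
Qed.

Lemma dcompM d e (x y : walg V c) :
  x \in dcomp d -> y \in dcomp e -> x * y \in dcomp (d + e).
Proof.
move: y => /[swap]; move: x; apply: dcomp_ind => [y _|a x x' hx hx' y hy|w <- ].
- by rewrite mul0r rpred0.
- by rewrite mulrDl -scalerAl rpredD ?rpredZ ?hx ?hx'.
apply: dcomp_ind => [|a y y' hy hy'|w' <-].
- by rewrite mulr0 rpred0.
- by rewrite mulrDr -scalerAr rpredD ?rpredZ ?hy ?hy'.
by rewrite -word_cat -wdeg_cat word_dcomp.
Qed.

Lemma lcomp_lproj n (x : walg V c) : lproj n x \in lcomp n.
Proof. by rewrite /lcomp unfold_in lproj_lproj eqxx. Qed.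

End WordAlgebras.

(** * Graded commutativity and the length filtration of S(V) *)

Section SymmetricAlgebra.
Variables (K : fieldType) (V : int -> lmodType K).
Implicit Types (w : seq (letter V)) (M N : lmodType K).

Lemma word_letterC (x : letter V) w :
  word true (x :: w) = (-1) ^ (ldeg x * wdeg w) *: word true (rcons w x).
Proof.
suff h v : word true (v ++ x :: w)
    = (-1) ^ (ldeg x * wdeg w) *: word true (v ++ rcons w x).
  exact: (h [::]).
elim: w v => [|y w IH] v; first by rewrite wdeg_nil mulr0 expr0z scale1r.
rewrite word_comm // wdeg_cons mulrDr sgnD -scalerA -cat_rcons IH.
by rewrite cat_rcons.
Qed.

Lemma word_mulC v w :
  word true v * word true w
  = (-1) ^ (wdeg v * wdeg w) *: (word true w * word true v).
Proof.
rewrite -!word_cat; elim: v w => [|x v IH] w.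
  by rewrite wdeg_nil mul0r expr0z scale1r cats0.
rewrite cat_cons word_letterC rcons_cat IH scalerA wdeg_cat -cats1 wdeg_cat.
rewrite !wdeg_cons wdeg_nil addr0 -sgnD -catA.
have -> : ldeg x * (wdeg v + wdeg w) + wdeg v * (wdeg w + ldeg x)
  = (ldeg x + wdeg v) * wdeg w + 2 * (ldeg x * wdeg v) by ring.
by rewrite sgnD sgn_double mulr1.
Qed.

Lemma dcomp_mulC d e (x y : SymAlg V) :
  x \in dcomp d -> y \in dcomp e -> x * y = (-1) ^ (d * e) *: (y * x).
Proof.
move: y => /[swap]; move: x; apply: dcomp_ind => [y _|a x x' hx hx' y hy|w <- ].
- by rewrite mulr0 mul0r scaler0.
- rewrite mulrDl mulrDr -scalerAl -scalerAr hx // hx' // scalerDr !scalerA.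
  by rewrite mulrC.
apply: dcomp_ind => [|a y y' hy hy'|w' <-].
- by rewrite mulr0 mul0r scaler0.
- rewrite mulrDl mulrDr -scalerAl -scalerAr hy // hy' // scalerDr !scalerA.
  by rewrite mulrC.
exact: word_mulC.
Qed.

Lemma sum_lproj (x : SymAlg V) :
  exists p, forall q, (p <= q)%N -> \sum_(j < q) lproj j x = x.
Proof.
elim/walg_ind: x => [|a x y [p1 h1] [p2 h2]|w].
- by exists 0%N => q _; rewrite big1 // => i _; rewrite linear0.
- exists (maxn p1 p2) => q; rewrite geq_max => /andP[h3 h4].
  rewrite -{2}(h1 q h3) -{2}(h2 q h4) scaler_sumr -big_split.
  by apply: eq_bigr => i _; rewrite linearP.
exists (size w).+1 => q hq; rewrite (bigD1 (Ordinal hq)) //= lproj_word eqxx.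
rewrite big1 ?addr0 // => i; rewrite lproj_word -val_eqE eq_sym /=.
by case: eqP.
Qed.

Lemma lleP m (x : SymAlg V) :
  reflect (forall j, (m < j)%N -> lproj j x = 0) (x \in lle m).
Proof.
apply: (iffP eqP) => [<- j mj|h].
  rewrite linear_sum big1 // => i _; rewrite /= lproj_lproj.
  by case: eqP => // ji; have := ltn_ord i; lia.
have [p hp] := sum_lproj x; rewrite -[RHS](hp (maxn m.+1 p)) ?leq_maxr //.
rewrite -!(big_mkord xpredT (fun j => lproj j x)).
rewrite [RHS](big_cat_nat (n := m.+1)) ?leq_maxl //=.
rewrite [X in _ = _ + X]big_nat_cond [X in _ = _ + X]big1 ?addr0 // => j.
by rewrite andbT => /andP[/h].
Qed.

Fact lle_submod_closed m : submod_closed (lle m : {pred SymAlg V}).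
Proof.
split=> [|a x y /lleP hx /lleP hy]; apply/lleP => j mj; first by rewrite linear0.
by rewrite linearP /= hx // hy // scaler0 addr0.
Qed.

HB.instance Definition _ m :=
  GRing.isSubmodClosed.Build K _ (lle m : {pred SymAlg V}) (@lle_submod_closed m).

Lemma lleW m n (x : SymAlg V) : (m <= n)%N -> x \in lle m -> x \in lle n.
Proof.
by move=> mn /lleP h; apply/lleP => j nj; apply: h; apply: leq_ltn_trans nj.
Qed.

Lemma word_lle w m : (size w <= m)%N -> word true w \in lle m.
Proof. by move=> wm; apply/lleP => j mj; rewrite lproj_word; case: eqP => //; lia. Qed.

Lemma lle_dcomp_ind d m (P : SymAlg V -> Prop) :
  P 0 -> (forall a x y, P x -> P y -> P (a *: x + y)) ->
  (forall w, wdeg w = d -> (size w <= m)%N -> P (word true w)) ->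
  forall x, x \in dcomp d -> x \in lle m -> P x.
Proof.
move=> P0 PP Pw x /dproj_id xd /eqP xm; rewrite -xd -xm => {xd xm}.
elim/walg_ind: x => [|a x y hx hy|w].
- by rewrite big1 ?linear0 // => i _; rewrite linear0.
- under eq_bigr do rewrite linearP.
  by rewrite big_split -scaler_sumr linearP; apply: PP.
rewrite linear_sum; apply: (big_ind P) => // [x y Px Py|i _].
  by rewrite -[x]scale1r; apply: PP.
rewrite lproj_word; case: eqP => wi; last by rewrite linear0.
by rewrite /= dproj_word; case: eqP => // wd; apply: Pw; rewrite // wi -ltnS.
Qed.

Lemma lle_ind m (P : SymAlg V -> Prop) :
  P 0 -> (forall a x y, P x -> P y -> P (a *: x + y)) ->
  (forall w, (size w <= m)%N -> P (word true w)) ->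
  forall x, x \in lle m -> P x.
Proof.
move=> P0 PP Pw x /eqP <-; elim/walg_ind: x => [|a x y hx hy|w].
- by rewrite big1 // => i _; rewrite linear0.
- under eq_bigr do rewrite linearP.
  by rewrite big_split -scaler_sumr; apply: PP.
apply: (big_ind P) => // [x y Px Py|i _].
  by rewrite -[x]scale1r; apply: PP.
by rewrite lproj_word; case: eqP => wi //; apply: Pw; rewrite // wi -ltnS.
Qed.

Lemma lleM m n (x y : SymAlg V) :
  x \in lle m -> y \in lle n -> x * y \in lle (m + n).
Proof.
move: y => /[swap]; move: x; apply: lle_ind => [y _|a x x' hx hx' y hy|w wm].
- by rewrite mul0r rpred0.
- by rewrite mulrDl -scalerAl rpredD ?rpredZ ?hx ?hx'.
apply: lle_ind => [|a y y' hy hy'|w' wn].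
- by rewrite mulr0 rpred0.
- by rewrite mulrDr -scalerAr rpredD ?rpredZ ?hy ?hy'.
by rewrite -word_cat word_lle // size_cat leq_add.
Qed.

Lemma lprojM n (x y : SymAlg V) :
  lproj n (x * y) = \sum_(i < n.+1) lproj i x * lproj (n - i) y.
Proof.
elim/walg_ind: x => [|a x x' hx hx'|v].
- by rewrite mul0r linear0 big1 // => i _; rewrite linear0 mul0r.
- rewrite mulrDl -scalerAl linearP /= hx hx' scaler_sumr -big_split.
  by apply: eq_bigr => i _; rewrite linearP /= mulrDl -scalerAl.
elim/walg_ind: y => [|a y y' hy hy'|w].
- by rewrite mulr0 linear0 big1 // => i _; rewrite linear0 mulr0.
- rewrite mulrDr -scalerAr linearP /= hy hy' scaler_sumr -big_split.
  by apply: eq_bigr => i _; rewrite linearP /= mulrDr -scalerAr.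
rewrite -word_cat lproj_word size_cat; case: eqP => [vwn|nvw].
  have vn : (size v < n.+1)%N by lia.
  rewrite (bigD1 (Ordinal vn)) //= big1 ?addr0 => [|i].
    by rewrite !lproj_word eqxx -vwn addKn eqxx word_cat.
  by rewrite -val_eqE /= eq_sym lproj_word => /negPf->; rewrite mul0r.
rewrite big1 // => i _; rewrite !lproj_word.
case: eqP => [vi|_]; last by rewrite mul0r.
case: eqP => [wi|_]; last by rewrite mulr0.
by case: nvw; have := ltn_ord i; lia.
Qed.

End SymmetricAlgebra.

(** * The coalgebra S(U) *)

Section SymmetricCoalgebra.
Variables (K : fieldType) (U : int -> lmodType K).
Implicit Types (w : seq (letter U)) (M N : lmodType K).

Definition letter_linear M (F : letter (gsym U) -> M) : Prop :=
  forall d a (u v : gsym U d),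
    F (mklet (a *: u + v)) = a *: F (mklet u) + F (mklet v).

(** * Linear functions of homogeneous elements of S(U) as linear functions on S(U) *)

Section LetterLinear.
Variables (M : lmodType K) (F : letter (gsym U) -> M).
Hypothesis F_lin : letter_linear F.

(** The degree of [wlet w] is part of its type, and related words have degrees that are equal only
    by a proof. Projecting to a fixed degree d allows F to be compared on them without transport. *)
Let Fd (d : int) (y : SymAlg U) : M :=
  F (mklet (V := gsym U) (SDeg (dproj_dcomp d y))).

Let Fd_linear d : linear (Fd d).
Proof.
move=> a y z; rewrite /Fd -F_lin; congr (F (mklet _)).
by apply: val_inj; rewrite /= linearP.
Qed.

HB.instance Definition _ d :=
  GRing.isLinear.Build K _ _ _ (Fd d) (Fd_linear d).

Let Fd_word d w : wdeg w = d -> F (wlet w) = Fd d (word true w).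
Proof.
by move=> <-; congr (F (mklet _)); apply: val_inj; rewrite /= dproj_id ?word_dcomp.
Qed.

Lemma compat_wlet : compat true (fun w => F (wlet w)).
Proof.
split=> [w1 w2 d a u v|_ w1 w2 x y].
  rewrite !(Fd_word (d := wdeg w1 + (d + wdeg w2))) ?wdeg_cat ?wdeg_cons //.
  by rewrite word_lin linearP.
rewrite !(Fd_word (d := wdeg w1 + (ldeg x + (ldeg y + wdeg w2))));
  rewrite ?wdeg_cat ?wdeg_cons //; last by rewrite [ldeg y + _]addrCA.
by rewrite word_comm // linearZ.
Qed.

Lemma letter_linearE x : F x = wlift (fun w => F (wlet w)) (lval x).
Proof.
rewrite -/(wext compat_wlet _).
have FE d y : Fd d y = wext compat_wlet (dproj d y).
  elim/walg_ind: y => [|a y z hy hz|w]; first by rewrite !linear0.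
    by rewrite !linearP /= hy hz.
  rewrite dproj_word; case: eqP => [wd|nwd]; first by rewrite -Fd_word // wextE.
  rewrite linear0 -[RHS](linear0 (Fd d)) /Fd; congr (F (mklet _)).
  by apply: val_inj; rewrite /= dproj_word linear0; case: eqP nwd.
case: x => d y; rewrite -[LHS]/(F (mklet y)).
have -> : mklet y = mklet (V := gsym U) (SDeg (dproj_dcomp d (sdeg_val y))).
  by congr mklet; apply: val_inj; rewrite /= dproj_id //; apply: valP.
rewrite -/(Fd d _) FE; congr (wext _ _).
by rewrite dproj_id //; apply: valP.
Qed.

End LetterLinear.

Lemma lval_wlet w : lval (wlet w) = word true w.
Proof. by []. Qed.

Lemma ldeg_wlet w : ldeg (wlet w) = wdeg w.
Proof. by []. Qed.

Lemma lval_linear : letter_linear (@lval K U).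
Proof. by []. Qed.

Lemma lval_dcomp x : lval x \in dcomp (K := K) (V := U) (c := true) (ldeg x).
Proof. by case: x => d y; apply: valP. Qed.

Lemma word_letter_linear c (w1 w2 : seq (letter (gsym U))) :
  letter_linear (fun x => word c (w1 ++ x :: w2)).
Proof. by move=> d a u v; apply: word_lin. Qed.

Lemma compat_sym_inj : compat true (fun w => word (V := gsym U) true [:: wlet w]).
Proof.
exact: (compat_wlet (F := fun x => word true [:: x]) (word_letter_linear true [::] [::])).
Qed.

HB.instance Definition _ :=
  GRing.isLinear.Build K _ _ _ (@sym_inj K U) (wlift_linear compat_sym_inj).

Lemma sym_inj_word w : sym_inj (word true w : SymAlg U) = word true [:: wlet w].
Proof. by rewrite /sym_inj wliftE //; apply: compat_sym_inj. Qed.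

Lemma sym_inj_lval x : sym_inj (lval x : SymAlg U) = word true [:: x].
Proof.
by rewrite [RHS](letter_linearE (F := fun y => word true [:: y])
                  (word_letter_linear true [::] [::])).
Qed.

Lemma cop_wordE w :
  cop_word (tnth (in_tuple w)) = unsh (fun a b => word false [:: wlet a; wlet b]) w.
Proof.
rewrite /cop_word (sum_unshuffle _ (fun a b => word false [:: wlet a; wlet b])).
by rewrite map_tnth_enum.
Qed.

Lemma compat_cop : compat true (fun w => cop_word (tnth (in_tuple w))).
Proof.
have h : compat true (unsh (fun a b : seq (letter U) => word false [:: wlet a; wlet b])).
  apply: compat_unsh => a.
    exact: (compat_wlet (F := fun x => word _ [:: x; wlet a])
      (word_letter_linear _ [::] [:: wlet a])).
  exact: (compat_wlet (F := fun x => word _ [:: wlet a; x])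
    (word_letter_linear _ [:: wlet a] [::])).
case: h => h1 h2; split=> [w1 w2 d a u v|hc w1 w2 x y]; rewrite !cop_wordE.
  exact: h1.
exact: h2.
Qed.

HB.instance Definition _ :=
  GRing.isLinear.Build K _ _ _ (@cop K U) (wlift_linear compat_cop).

Lemma copE w :
  cop (word true w : SymAlg U) = unsh (fun a b => word false [:: wlet a; wlet b]) w.
Proof. by rewrite /cop wliftE ?cop_wordE //; apply: compat_cop. Qed.

Lemma compat_pair M (G : letter (gsym U) -> letter (gsym U) -> M) :
  (forall y, letter_linear (G^~ y)) -> (forall x, letter_linear (G x)) ->
  compat false (fun u => if u is [:: x; y] then G x y else 0).
Proof.
move=> Gl Gr; split=> // w1 w2 d a u v.
case: w1 => [|x [|y w1]]; case: w2 => [|z [|t w2]] //=; rewrite ?scaler0 ?addr0 //.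
- exact: Gl.
- exact: Gr.
- by case: w1 => //=; rewrite scaler0 addr0.
- by case: w1 => //=; rewrite scaler0 addr0.
- by case: w1 => //=; rewrite scaler0 addr0.
Qed.

Lemma pair_cop M (G : letter (gsym U) -> letter (gsym U) -> M) w :
  (forall y, letter_linear (G^~ y)) -> (forall x, letter_linear (G x)) ->
  wlift (fun u : seq (letter (gsym U)) => if u is [:: x; y] then G x y else 0)
    (cop (word true w : SymAlg U))
  = unsh (fun a b => G (wlet a) (wlet b)) w.
Proof.
move=> Gl Gr; rewrite copE -/(wext (compat_pair Gl Gr) _) unsh_linear.
by apply: eq_unsh => a b; rewrite /= wextE.
Qed.

Lemma compat_antipode : compat true (fun w => (-1) ^+ size w *: word (V := U) true w).
Proof.
split=> [w1 w2 d a u v|_ w1 w2 x y].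
  rewrite !size_cat /= word_lin scalerDr !scalerA; congr (_ *: _ + _).
  by rewrite mulrC.
by rewrite !size_cat /= word_comm // !scalerA mulrC.
Qed.

HB.instance Definition _ :=
  GRing.isLinear.Build K _ _ _ (@antipode K U) (wlift_linear compat_antipode).

Lemma antipode_word w : antipode (word true w : SymAlg U) = (-1) ^+ size w *: word true w.
Proof. by rewrite /antipode wliftE //; apply: compat_antipode. Qed.

(** The map phi = D * s on words. *)
Definition convs (D : SymAlg U -> SymAlg U) w : SymAlg U :=
  unsh (fun a b => (-1) ^+ size b *: (D (word true a) * word true b)) w.

Lemma mul_letter_linearl (D : {linear SymAlg U -> SymAlg U}) (z : SymAlg U) :
  letter_linear (fun x => D (lval x) * z).
Proof. by move=> d a u v; rewrite lval_linear linearP mulrDl -scalerAl. Qed.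

Lemma mul_letter_linearr (D : {linear SymAlg U -> SymAlg U}) (z : SymAlg U) :
  letter_linear (fun x => z * D (lval x)).
Proof. by move=> d a u v; rewrite lval_linear linearP mulrDr -scalerAr. Qed.

Let pairs (D : {linear SymAlg U -> SymAlg U}) (x y : letter (gsym U)) : SymAlg U :=
  (-1) ^ (0 * ldeg x) *: (D (lval x) * antipode (lval y)).

Let pairs_linearl D y : letter_linear (fun x => pairs D x y).
Proof.
by move=> d a u v; rewrite /pairs !mul0r !expr0z !scale1r mul_letter_linearl.
Qed.

Let pairs_linearr D x : letter_linear (pairs D x).
Proof.
by move=> d a u v; rewrite /pairs !mul0r !expr0z !scale1r mul_letter_linearr.
Qed.

Lemma conv_antipodeE (D : {linear SymAlg U -> SymAlg U}) w :
  conv 0 D (@antipode K U) (word true w) = convs D w.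
Proof.
rewrite /conv (pair_cop w (pairs_linearl D) (pairs_linearr D)).
apply: eq_unsh => a b; rewrite /pairs mul0r expr0z scale1r antipode_word.
by rewrite -scalerAr.
Qed.

Lemma conv_antipode_linear (D : {linear SymAlg U -> SymAlg U}) :
  linear (conv 0 D (@antipode K U)).
Proof.
move=> a x y; rewrite /conv linearP.
by rewrite (wlift_linear (compat_pair (pairs_linearl D) (pairs_linearr D))).
Qed.

Lemma conv_antipode_lle (D : {linear SymAlg U -> SymAlg U}) m :
  (forall x, conv 0 D (@antipode K U) x \in lle m) <->
  (forall w, convs D w \in lle m).
Proof.
split=> [h w|h x]; first by rewrite -conv_antipodeE.
elim/walg_ind: x => [|a x y hx hy|w]; last by rewrite conv_antipodeE.
  by rewrite (linear_fun0 (conv_antipode_linear D)) rpred0.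
by rewrite conv_antipode_linear; apply: rpredD => //; apply: rpredZ.
Qed.

End SymmetricCoalgebra.

(** * Koszul brackets *)

Section KoszulBrackets.
Variables (K : fieldType) (U : int -> lmodType K).
Implicit Types (w : seq (letter U)) (D : {linear SymAlg U -> SymAlg U}).

Definition kbracket (D : SymAlg U -> SymAlg U) (s : seq (letter (gsym U))) : SymAlg U :=
  unsh (fun A B => (-1) ^+ size B *:
    (D (\prod_(x <- A) lval x) * \prod_(x <- B) lval x)) s.

(** The bracket is summed from i = 1 and [kbracket] from i = 0; the additional term has the factor D
    1 = 0. *)
Lemma koszul_bracketE D n (x : 'I_n -> letter (gsym U)) : D 1 = 0 ->
  koszul_bracket D x = kbracket D [seq x k | k <- enum 'I_n].
Proof.
move=> D1; rewrite /kbracket -sum_unshuffle.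
rewrite -(big_mkord xpredT (fun i => \sum_(s : 'S_n | unshuffle i s)
  koszul_sign x s *: ((-1) ^+ size (drop i (perm_word x s)) *:
    (D (\prod_(y <- take i (perm_word x s)) lval y)
     * \prod_(y <- drop i (perm_word x s)) lval y)))).
rewrite [RHS]big_ltn // big1 ?add0r => [|s _]; last first.
  by rewrite take0 big_nil D1 mul0r !scaler0.
rewrite /koszul_bracket; apply: eq_bigr => i _; apply: eq_bigr => s _.
by rewrite size_drop size_map size_enum_ord scalerA.
Qed.

Lemma kbracket_letters D w : kbracket D [seq wlet [:: u] | u <- w] = convs D w.
Proof.
rewrite /kbracket /convs.
pose wl (u : letter U) := wlet [:: u].
have prodE a : \prod_(x <- map wl a) lval x = word true a :> SymAlg U.
  elim: a => [|u a IH]; first by rewrite big_nil.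
  by rewrite /= big_cons IH -[u :: a]/([:: u] ++ a) word_cat.
have wdegE a : wdeg (map wl a) = wdeg a.
  by rewrite /wdeg big_map; apply: eq_bigr => u _; rewrite /wl ldeg_wlet /wdeg big_seq1.
have unshE (F : seq (letter (gsym U)) -> seq (letter (gsym U)) -> SymAlg U) :
    unsh F (map wl w) = unsh (fun a b => F (map wl a) (map wl b)) w.
  elim: w F => //= u w IH F; rewrite !IH; congr (_ + _).
  by apply: eq_unsh => a b; rewrite wdegE wdeg_cons wdeg_nil addr0.
by rewrite unshE; apply: eq_unsh => a b; rewrite !prodE size_map.
Qed.

(** The graded commutator [D, L_y] at z, for D of degree p and y of degree d. *)
Definition gcomm D (p d : int) (y z : SymAlg U) : SymAlg U :=
  D (y * z) - (-1) ^ (p * d) *: (y * D z).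

Fact gcomm_linear D p d y : linear (gcomm D p d y).
Proof.
move=> a z t; rewrite /gcomm mulrDr -scalerAr !(linearP D) mulrDr -scalerAr.
by rewrite !scalerDr !scalerN !scalerA opprD addrACA [a * _]mulrC.
Qed.

HB.instance Definition _ D p d y :=
  GRing.isLinear.Build K _ _ _ (gcomm D p d y) (gcomm_linear D p d y).

Lemma gcomm_degree D p d y :
  has_degree p D -> y \in dcomp d -> has_degree (p + d) (gcomm D p d y).
Proof.
move=> Dp yd e z ze; rewrite /gcomm.
have h1 : D (y * z) \in dcomp (e + (p + d)).
  by rewrite (_ : e + _ = d + e + p); [apply/Dp/dcompM|ring].
have h2 : y * D z \in dcomp (e + (p + d)).
  by rewrite (_ : e + _ = d + (e + p)); [apply/dcompM/Dp|ring].
by apply: rpredB h1 _; apply: rpredZ.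
Qed.

(* The part of the bracket with D applied to the empty product is included,    *)
(* which makes kbracket D s the iterated commutator of D with the left         *)
(* multiplications by the entries of s, evaluated at 1.                        *)
Lemma kbracket_cons D p x s : has_degree p D ->
  kbracket D (x :: s) = kbracket (gcomm D p (ldeg x) (lval x)) s.
Proof.
move=> Dp; rewrite /kbracket /= -unshD; apply: eq_unsh => A B.
rewrite !big_cons /gcomm mulrBl scalerBr; congr (_ + _).
have Ad : D (\prod_(y <- A) lval y) \in dcomp (wdeg A + p).
  apply: Dp; elim: A => [|y A IH].
    by rewrite big_nil wdeg_nil -(wdeg_nil U) word_dcomp.
  by rewrite big_cons wdeg_cons dcompM ?lval_dcomp.
(* Moving x to the left of D(...) cancels the sign of the unshuffle and leaves (-1)^(p |x|). *)
rewrite mulrA (dcomp_mulC Ad (lval_dcomp x)) exprS mulN1r scaleNr scalerN.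
congr (- _); rewrite -!scalerAl !scalerA; congr (_ *: _).
rewrite [X in X * _]mulrC -mulrA -sgnD; congr (_ * _).
rewrite (_ : _ + _ = 2 * (wdeg A * ldeg x) + p * ldeg x); last by ring.
by rewrite sgnD sgn_double mul1r.
Qed.

Lemma convs_letter D p x w : has_degree p D ->
  convs (gcomm D p (ldeg x) (word true [:: x])) w = convs D (x :: w).
Proof.
move=> Dp; rewrite -!kbracket_letters.
rewrite [RHS](kbracket_cons (p := p)) // ldeg_wlet /wdeg big_seq1.
by [].
Qed.

Lemma eq_convs (D1 D2 : SymAlg U -> SymAlg U) w :
  D1 =1 D2 -> convs D1 w = convs D2 w.
Proof. by move=> h; apply: eq_unsh => a b; rewrite h. Qed.

Lemma convsP a (D1 D2 : SymAlg U -> SymAlg U) w :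
  convs (fun z => a *: D1 z + D2 z) w = a *: convs D1 w + convs D2 w.
Proof.
rewrite /convs -unshP; apply: eq_unsh => A B.
by rewrite mulrDl scalerDr -scalerAl !scalerA mulrC.
Qed.

Lemma convs0 w : convs (fun=> 0 : SymAlg U) w = 0.
Proof.
by rewrite -[RHS](unsh0 _ w); apply: eq_unsh => a b; rewrite mul0r scaler0.
Qed.

Lemma convs_mull (y : SymAlg U) (D : SymAlg U -> SymAlg U) w :
  convs (fun z => y * D z) w = y * convs D w.
Proof.
rewrite /convs -unsh_mull.
by apply: eq_unsh => A B; rewrite /= -scalerAr mulrA.
Qed.

(** D(xyz) is commuted past x and then past y, with [D, L_x] L_y written as [[D, L_x], L_y] +/- L_y
    [D, L_x]. *)
Lemma gcomm_mul D p d e (x y z : SymAlg U) :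
  gcomm D p (d + e) (x * y) z
  = (-1) ^ (p * d) *: (x * gcomm D p e y z)
    + ((-1) ^ ((p + d) * e) *: (y * gcomm D p d x z)
       + gcomm (gcomm D p d x) (p + d) e y z).
Proof.
pose D' := [the {linear _ -> _} of gcomm D p d x].
rewrite -/D' -[gcomm D' _ _ _ _]/(D' (y * z) - (-1) ^ ((p + d) * e) *: (y * D' z)).
rewrite [X in _ = _ + X]addrC subrK /D' /= /gcomm mulrBr scalerBr -!scalerAr !scalerA.
by rewrite -sgnD -mulrDr !mulrA [RHS]addrC addrA subrK.
Qed.

(** Induction on v for all D at once, since the product rule for x v' involves [D, L_x] as well as
    D. For nonempty v' of length l, its three terms have length at most 1 + (m + l - 1), l + m and m
    + l - 1. A single letter costs nothing by [convs_letter], and the commutator with the empty word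
    is 0. *)
Lemma convs_gcomm_word m v D p : has_degree p D ->
  (forall w, convs D w \in lle m) ->
  forall w, convs (gcomm D p (wdeg v) (word true v)) w \in lle (m + (size v).-1).
Proof.
elim: v D p m => [|x v IH] D p m Dp Dm w.
  rewrite (@eq_convs _ (fun=> 0)) ?convs0 ?rpred0 // => z.
  by rewrite /gcomm wdeg_nil mulr0 expr0z scale1r !mul1r subrr.
have D'm w' : convs (gcomm D p (ldeg x) (word true [:: x])) w' \in lle m.
  by rewrite convs_letter.
case: v IH => [|y v] IH.
  by rewrite addn0 wdeg_cons wdeg_nil addr0.
rewrite wdeg_cons -[x :: _]/([:: x] ++ _) word_cat.
rewrite (eq_convs _ (gcomm_mul D p _ _ _ _)) !convsP !convs_mull.
have xlle : word true [:: x] \in lle 1 by apply: word_lle.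
have h1 := lleM xlle (IH D p m Dp Dm w).
have vlle : word true (y :: v) \in lle (size v).+1 by apply: word_lle.
have h2 := lleM vlle (D'm w).
have xd : word true [:: x] \in dcomp (ldeg x).
  by have := word_dcomp true [:: x]; rewrite wdeg_cons wdeg_nil addr0.
have h3 := IH _ _ m (gcomm_degree Dp xd) D'm w.
apply: rpredD; first by apply: rpredZ; apply: lleW h1; rewrite /=; lia.
apply: rpredD; first by apply: rpredZ; apply: lleW h2; rewrite /=; lia.
by apply: lleW h3; rewrite /=; lia.
Qed.

Lemma convs_gcomm m i D p x : has_degree p D ->
  (forall w, convs D w \in lle m) -> lval x \in lle i ->
  forall w, convs (gcomm D p (ldeg x) (lval x)) w \in lle (m + i.-1).
Proof.
move=> Dp Dm xi w; move: (lval_dcomp x) xi.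
apply: (lle_dcomp_ind (P := fun y => convs (gcomm D p (ldeg x) y) w \in lle (m + i.-1))).
- rewrite (@eq_convs _ (fun=> 0)) ?convs0 ?rpred0 // => z.
  by rewrite /gcomm !mul0r linear0 scaler0 subrr.
- move=> a y z hy hz.
  rewrite (@eq_convs _ (fun t => a *: gcomm D p (ldeg x) y t + gcomm D p (ldeg x) z t)).
    by rewrite convsP; apply: rpredD => //; apply: rpredZ.
  move=> t; rewrite /gcomm !mulrDl -!scalerAl linearP !scalerDr scalerN !scalerA.
  by rewrite opprD addrACA [a * _]mulrC.
move=> v <- vi; apply: lleW (convs_gcomm_word v Dp Dm w).
by lia.
Qed.

Lemma kbracket_lle k (x : 'I_k -> letter (gsym U)) (i : 'I_k -> nat) (r : seq 'I_k)
    m D p :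
  has_degree p D -> (forall w, convs D w \in lle m) ->
  (forall j, lval (x j) \in lle (i j)) ->
  kbracket D [seq x j | j <- r] \in lle (m + \sum_(j <- r) (i j).-1)%N.
Proof.
move=> + + xi; elim: r D p m => [|j r IH] D p m Dp Dm.
  rewrite big_nil addn0; have := Dm [::].
  by rewrite /kbracket /convs /= !big_nil.
rewrite /= (kbracket_cons _ _ Dp) big_cons addnA.
apply: IH (gcomm_degree Dp (lval_dcomp _)) _.
by apply: convs_gcomm.
Qed.

End KoszulBrackets.

(** * Symmetric powers of the inclusion *)

Section KoszulCobrackets.
Variables (K : fieldType) (U : int -> lmodType K).
Implicit Types (w : seq (letter U)) (D : {linear SymAlg U -> SymAlg U}).
Local Notation S2U := (SymAlg (gsym U)).
Local Notation iota1 w := (word (V := gsym U) true [:: wlet w]).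

(** The convolution powers of the inclusion iota; the power 0 is the counit followed by the unit. *)
Fixpoint ipow (k : nat) w : S2U :=
  if k is k'.+1 then unsh (fun a b => iota1 a * ipow k' b) w
  else (w == [::])%:R.

Lemma compat_mulr (A : algType K) (V : int -> lmodType K) c
    (f : seq (letter V) -> A) (y : A) :
  compat c f -> compat c (fun v => f v * y).
Proof.
move=> [fl fs]; split=> [w1 w2 d a u v|hc w1 w2 x z].
  by rewrite fl mulrDl -scalerAl.
by rewrite fs // -scalerAl.
Qed.

Lemma compat_mull (A : algType K) (V : int -> lmodType K) c
    (f : seq (letter V) -> A) (y : A) :
  compat c f -> compat c (fun v => y * f v).
Proof.
move=> [fl fs]; split=> [w1 w2 d a u v|hc w1 w2 x z].
  by rewrite fl mulrDr -scalerAr.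
by rewrite fs // -scalerAr.
Qed.

Lemma compat_ipow k : compat true (ipow k).
Proof.
elim: k => [|k IH] /=.
  split=> [w1 w2 d a u v|_ w1 w2 x y]; case: w1 => [|z w1] /=;
    by rewrite !(mulr0n, addr0, scaler0).
apply: compat_unsh => b.
  exact/compat_mulr/compat_sym_inj.
exact: compat_mull.
Qed.

Definition Ipow k : SymAlg U -> S2U := wext (compat_ipow k).
HB.instance Definition _ k := GRing.Linear.on (Ipow k).

Lemma Ipow_word k w : Ipow k (word true w) = ipow k w.
Proof. exact: wextE. Qed.

Lemma ipowD i j w : ipow (i + j) w = unsh (fun a b => ipow i a * ipow j b) w.
Proof.
elim: i w => [|i IH] w /=.
  rewrite -[LHS](unsh_nill (fun _ b => ipow j b)); apply: eq_unsh => - [|x a] b.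
    by rewrite mul1r.
  by rewrite mul0r.
transitivity (unsh (fun a b =>
    unsh (fun b1 b2 => iota1 a * (ipow i b1 * ipow j b2)) b) w).
  by apply: eq_unsh => a b; rewrite unsh_mull IH.
rewrite -unshA; apply: eq_unsh => a b; rewrite -unsh_mulr.
by apply: eq_unsh => a1 a2; rewrite mulrA.
Qed.

Lemma ipow1 w : ipow 1 w = iota1 w.
Proof.
rewrite /= -[RHS](unsh_nilr (fun a _ => iota1 a)); apply: eq_unsh => a [|x b].
  by rewrite mulr1.
by rewrite mulr0.
Qed.

Lemma ipow_dcomp k w : ipow k w \in dcomp (wdeg w).
Proof.
elim: k w => [|k IH] w /=.
  case: w => [|x w]; first by rewrite wdeg_nil -(wdeg_nil (gsym U)) word_dcomp.
  exact: rpred0.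
apply: unsh_closed_in => a b <-; apply: dcompM (IH b).
by have := word_dcomp true [:: wlet a]; rewrite wdeg_cons wdeg_nil addr0.
Qed.

Lemma Ipow_dcomp k d x : x \in dcomp d -> Ipow k x \in dcomp d.
Proof.
move: x; apply: dcomp_ind => [|a x y hx hy|w <-]; first by rewrite linear0 rpred0.
  by rewrite linearP; apply: rpredD => //; apply: rpredZ.
by rewrite Ipow_word ipow_dcomp.
Qed.

Lemma lproj_letter_mul k (y : letter (gsym U)) (z : S2U) :
  lproj k.+1 (word true [:: y] * z) = word true [:: y] * lproj k z.
Proof.
elim/walg_ind: z => [|a z t hz ht|v]; first by rewrite mulr0 !linear0 mulr0.
  by rewrite mulrDr -scalerAr !linearP /= hz ht mulrDr scalerAr.
rewrite -word_cat !lproj_word /= eqSS; case: eqP => // _; last by rewrite mulr0.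
by rewrite -word_cat.
Qed.

Lemma lproj_ipow k w : lproj k (ipow k w) = ipow k w.
Proof.
elim: k w => [|k IH] w /=.
  by case: w => [|x w]; rewrite ?linear0 //; apply: lproj_word.
rewrite unsh_linear; apply: eq_unsh => a b.
by rewrite /= lproj_letter_mul IH.
Qed.

Lemma Ipow_lcomp k x : Ipow k x \in lcomp k.
Proof.
suff -> : Ipow k x = lproj k (Ipow k x) by apply: lcomp_lproj.
move: x; apply: (walg_linear_eq (f := Ipow k) (g := lproj k \o Ipow k)) => w.
by rewrite /= Ipow_word lproj_ipow.
Qed.

(** * Iterated coproducts and convolution powers *)

Section IteratedCoproduct.

(** [iter_cop] always splits the first tensor factor, so the induction needs an arbitrary map F
    there. One more splitting replaces F by F * iota ([Psi_step]), and n splittings give F * iota^n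
    ([Psi_icop]). *)
Let Psi_word (F : letter (gsym U) -> S2U) (v : seq (letter (gsym U))) : S2U :=
  if v is y :: v' then F y * word true v' else 0.

Let compat_Psi F : letter_linear F -> compat false (Psi_word F).
Proof.
move=> Fl; split=> // - [|z w1] w2 d a u v /=.
  by rewrite Fl mulrDl -scalerAl.
by rewrite word_lin mulrDr -scalerAr.
Qed.

Local Notation icop := (iter_cop (fun y => cop (lval y))).

Let step_word (v : seq (letter (gsym U))) : TensAlg (gsym U) :=
  if v is y :: v' then cop (lval y) * word false v' else 0.

Let compat_step : compat false step_word.
Proof.
split=> // - [|z w1] w2 d a u v /=.
  by rewrite lval_linear linearP mulrDl -scalerAl.
by rewrite word_lin mulrDr -scalerAr.
Qed.

Let icopS n x : icop n.+1 x = wext compat_step (icop n x).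
Proof. by []. Qed.

Let conv_iota (F : letter (gsym U) -> S2U) (y : letter (gsym U)) : S2U :=
  wlift (fun v : seq (letter (gsym U)) =>
    if v is [:: a; b] then F a * word true [:: b] else 0) (cop (lval y)).

Let compat_conv_iota F (Fl : letter_linear F) :
  compat false (fun v : seq (letter (gsym U)) =>
    if v is [:: a; b] then F a * word true [:: b] else 0).
Proof.
apply: (compat_pair (G := fun a b => F a * word true [:: b])).
  by move=> y d a u v; rewrite Fl mulrDl -scalerAl.
move=> y d a u v; rewrite (word_letter_linear true [::] [::]).
by rewrite mulrDr -scalerAr.
Qed.

Let conv_iota_linear F (Fl : letter_linear F) : letter_linear (conv_iota F).
Proof.
move=> d a u v; rewrite /conv_iota lval_linear linearP.
exact: (wlift_linear (compat_conv_iota Fl)).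
Qed.

Let conv_iota_wlet F (Fl : letter_linear F) w :
  conv_iota F (wlet w) = unsh (fun a b => F (wlet a) * iota1 b) w.
Proof.
rewrite /conv_iota lval_wlet.
apply: (pair_cop (G := fun a b => F a * word true [:: b])).
  by move=> y d a u v; rewrite Fl mulrDl -scalerAl.
move=> y d a u v; rewrite (word_letter_linear true [::] [::]).
by rewrite mulrDr -scalerAr.
Qed.

Let Psi_step F (Fl : letter_linear F) t :
  wlift (Psi_word F) (wext compat_step t) = wlift (Psi_word (conv_iota F)) t.
Proof.
have Fl' := conv_iota_linear Fl.
rewrite -/(wext (compat_Psi Fl) _) -/(wext (compat_Psi Fl') _).
move: t; apply: (walg_linear_eq (f := wext (compat_Psi Fl) \o wext compat_step)).
case=> [|y v]; rewrite /= !wextE /= ?linear0 //.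
rewrite /conv_iota -/(wext (compat_conv_iota Fl) _).
elim/walg_ind: (lval y) => [|a z t hz ht|w].
- by rewrite !linear0 !mul0r !linear0.
- by rewrite !linearP mulrDl -scalerAl !linearP /= hz ht mulrDl -scalerAl.
rewrite copE unsh_linear -!unsh_mulr unsh_linear; apply: eq_unsh => a b.
by rewrite /= -word_cat !wextE /= -mulrA -word_cat.
Qed.

Let Psi_icop n F (Fl : letter_linear F) x :
  wlift (Psi_word F) (icop n x)
  = wlift (unsh (fun a b => F (wlet a) * ipow n b)) (lval x).
Proof.
elim: n F Fl => [|n IH] F Fl.
  rewrite /= wliftE; last exact: compat_Psi.
  rewrite /= mulr1 (letter_linearE Fl); congr (wlift _ _).
  apply: funext => w; rewrite -[LHS](unsh_nilr (fun a _ => F (wlet a))).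
  by apply: eq_unsh => a [|y b]; rewrite ?mulr1 ?mulr0.
rewrite icopS Psi_step // IH; last exact: conv_iota_linear.
congr (wlift _ _); apply: funext => w.
transitivity (unsh (fun a b =>
    unsh (fun a1 a2 => F (wlet a1) * (iota1 a2 * ipow n b)) a) w).
  apply: eq_unsh => a b; rewrite conv_iota_wlet // -unsh_mulr.
  by apply: eq_unsh => a1 a2; rewrite mulrA.
by rewrite unshA; apply: eq_unsh => a b; rewrite unsh_mull.
Qed.

Lemma tens_sym_iter_cop n x : tens_sym (icop n x) = Ipow n.+1 (lval x).
Proof.
have il : letter_linear (fun y : letter (gsym U) => word true [:: y]).
  exact: (word_letter_linear true [::] [::]).
suff -> : tens_sym (icop n x) = wlift (Psi_word (fun y => word true [:: y])) (icop n x).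
  by rewrite Psi_icop.
have cw : compat false (fun v => word (V := gsym U) true v).
  by split=> // *; apply: word_lin.
(* The two maps differ only on the empty word: for n = 0 there is one letter, and otherwise the last
   splitting step maps the empty word to 0. *)
case: n => [|n].
  by rewrite /tens_sym !wliftE /= -?word_cat //; apply: compat_Psi.
rewrite icopS /tens_sym -/(wext cw _) -/(wext (compat_Psi il) _).
apply: (walg_linear_eq (f := wext cw \o wext compat_step)
                       (g := wext (compat_Psi il) \o wext compat_step)).
case=> [|y v]; rewrite /= !wextE /= ?linear0 //.
elim/walg_ind: (lval y) => [|a z t hz ht|w].
- by rewrite !linear0 !mul0r !linear0.
- by rewrite !linearP mulrDl -scalerAl !linearP /= hz ht.
rewrite copE -!unsh_mulr !unsh_linear; apply: eq_unsh => a b.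
by rewrite /= -word_cat !wextE /= -word_cat.
Qed.

End IteratedCoproduct.

End KoszulCobrackets.

(** * Derivations *)

Section Derivations.
Variables (K : fieldType) (U : int -> lmodType K).
Variables (D : {linear SymAlg U -> SymAlg U}) (p : int).
Hypothesis D_deg : has_degree p D.
Implicit Types (w : seq (letter U)).
Local Notation S2U := (SymAlg (gsym U)).
Local Notation iota1 w := (word (V := gsym U) true [:: wlet w]).
Local Notation dlet := (fun y : letter (gsym U) => sym_inj (D (lval y))).

Lemma sym_inj_dcomp d (x : SymAlg U) : x \in dcomp d -> sym_inj x \in dcomp d.
Proof.
move: x; apply: dcomp_ind => [|a x y hx hy|w <-]; first by rewrite linear0 rpred0.
  by rewrite linearP; apply: rpredD => //; apply: rpredZ.
rewrite sym_inj_word; have := word_dcomp true [:: wlet w].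
by rewrite wdeg_cons wdeg_nil addr0.
Qed.

Lemma dlet_dcomp y : dlet y \in dcomp (ldeg y + p).
Proof. by apply/sym_inj_dcomp/D_deg/lval_dcomp. Qed.

Lemma dlet_linear : letter_linear dlet.
Proof. by move=> d a u v; rewrite lval_linear !linearP. Qed.

Lemma der_word_cons y v :
  der_word p dlet (y :: v)
  = dlet y * word true v + (-1) ^ (p * ldeg y) *: (word true [:: y] * der_word p dlet v).
Proof.
rewrite /der_word /= big_ord_recl /= wdeg_nil mulr0 expr0z scale1r drop0 mul1r.
congr (_ * _ + _).
rewrite mulr_sumr scaler_sumr; apply: eq_bigr => i _.
rewrite wdeg_cons mulrDr sgnD -scalerA -!scalerAr; congr (_ *: (_ *: _)).
rewrite -[y :: take i v]/([:: y] ++ take i v) word_cat -!mulrA.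
by rewrite !(tnth_nth y).
Qed.

Lemma compat_der_word : compat true (der_word p dlet).
Proof.
split=> [w1 w2 d a u v|_ w1 w2 x y]; elim: w1 => [|z w1 IH] /=.
- rewrite !der_word_cons dlet_linear (word_letter_linear true [::] [::]).
  rewrite !mulrDl -!scalerAl !scalerDr !scalerA [_ * a]mulrC addrACA.
  by [].
- rewrite !der_word_cons IH word_lin !mulrDr -!scalerAr !scalerDr !scalerA.
  by rewrite [_ * a]mulrC addrACA.
- rewrite !der_word_cons -[x :: w2]/([:: x] ++ w2) -[y :: w2]/([:: y] ++ w2).
  rewrite !word_cat !mulrDr !scalerDr -!scalerAr !scalerA !mulrA.
  rewrite (dcomp_mulC (dlet_dcomp x) (letter_dcomp true y)).
  rewrite (dcomp_mulC (letter_dcomp true x) (dlet_dcomp y)).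
  rewrite (dcomp_mulC (letter_dcomp true x) (letter_dcomp true y)).
  rewrite -!scalerAl !scalerA addrCA; congr (_ *: _ + (_ *: _ + _ *: _)).
  + rewrite -sgnD (_ : _ + _ = 2 * (p * ldeg x) + ldeg x * ldeg y); last by ring.
    by rewrite sgnD sgn_double mul1r.
  + by rewrite -sgnD; congr (_ ^ _); ring.
  + by ring.
- rewrite !der_word_cons IH word_comm // -!scalerAr !scalerDr !scalerA.
  by rewrite [X in _ + X *: _]mulrC.
Qed.

Definition dext : S2U -> S2U := wext compat_der_word.
HB.instance Definition _ := GRing.Linear.on dext.

Lemma dextE x : dext x = wlift (der_word p dlet) x.
Proof. by []. Qed.

Lemma dext_letter_mul y z :
  dext (word true [:: y] * z)
  = dlet y * z + (-1) ^ (p * ldeg y) *: (word true [:: y] * dext z).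
Proof.
elim/walg_ind: z => [|a z t hz ht|v]; first by rewrite !(mulr0, linear0) addr0.
  rewrite mulrDr -scalerAr !linearP /= hz ht !mulrDr -!scalerAr !scalerDr !scalerA.
  by rewrite [_ * a]mulrC addrACA.
by rewrite -word_cat /dext !wextE der_word_cons.
Qed.

Definition dconv k w : S2U :=
  unsh (fun a b => sym_inj (D (word true a)) * ipow k b) w.

Lemma dext1 : dext 1 = 0.
Proof. by rewrite /dext -[1]/(word true [::]) wextE /der_word big_ord0. Qed.

(** The derivation meets each of the k + 1 equal factors, and graded cocommutativity moves the
    factor met to the front. *)
Lemma dext_ipow k w : dext (ipow k.+1 w) = k.+1%:R *: dconv k w.
Proof.
elim: k w => [|k IH] w; rewrite [ipow _ _]/= unsh_linear.
  rewrite scale1r; apply: eq_unsh => a b; rewrite /= dext_letter_mul.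
  suff -> : dext (b == [::])%:R = 0 by rewrite mulr0 scaler0 addr0.
  by case: (b == [::]); rewrite ?dext1 ?linear0.
transitivity (dconv k.+1 w + k.+1%:R *: unsh (fun a b =>
    unsh (fun b1 b2 => (-1) ^ (p * wdeg a) *:
      (iota1 a * (sym_inj (D (word true b1)) * ipow k b2))) b) w).
  rewrite -unshZ -unshD; apply: eq_unsh => a b.
  rewrite -[LHS]/(dext (iota1 a * ipow k.+1 b)) dext_letter_mul IH unshZ unsh_mull.
  congr (_ + _).
  by rewrite -scalerAr !scalerA mulrC.
rewrite [in RHS]mulrS scalerDl scale1r -unshA; congr (_ + _ *: _).
transitivity (unsh (fun a b => unsh (fun a1 a2 =>
    sym_inj (D (word true a1)) * (iota1 a2 * ipow k b)) a) w); last first.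
  by rewrite unshA; apply: eq_unsh => a b; rewrite unsh_mull.
apply: eq_unsh => a b; rewrite unshC; apply: eq_unsh => a1 a2.
have h1 : sym_inj (D (word true a1)) \in dcomp (wdeg a1 + p).
  by apply/sym_inj_dcomp/D_deg/word_dcomp.
have h2 := letter_dcomp true (wlet a2); rewrite ldeg_wlet in h2.
rewrite !mulrA (dcomp_mulC h2 h1) -scalerAl !scalerA -!sgnD.
rewrite (_ : _ + _ = 2 * (wdeg a1 * wdeg a2 + p * wdeg a2)); last by ring.
by rewrite sgn_double scale1r.
Qed.

End Derivations.

(** * The exponential series *)

Section ExponentialSeries.
Variable K : fieldType.
Hypothesis charK0 : [pchar K] =i pred0.

Lemma natr_neq0 n : (n.+1%:R : K) != 0.
Proof. by rewrite (pcharf0P K).1. Qed.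

Lemma fact_neq0 n : (n`!%:R : K) != 0.
Proof. by rewrite (pcharf0P K).1 // -lt0n fact_gt0. Qed.

Lemma binr_fact m i : (i <= m)%N ->
  'C(m, i)%:R / m`!%:R = (i`!%:R)^-1 / (m - i)`!%:R :> K.
Proof.
move=> im; rewrite -(bin_fact im) !natrM.
have := fact_neq0 i; have := fact_neq0 (m - i); have : 'C(m, i)%:R != 0 :> K.
  by rewrite (pcharf0P K).1 // -lt0n bin_gt0.
by move=> h1 h2 h3; field; rewrite h1 h2 h3.
Qed.

Variable N : nat.

(** The series exp(t) - 1 cut off after t^N; components of order n at most N only see coefficients
    of order at most n. *)
Definition expm1 : {poly K} :=
  \poly_(i < N.+1) (if i == 0%N then 0 else (i`!%:R)^-1).

Lemma coef_expm1 i : (i <= N)%N ->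
  expm1`_i = if i == 0%N then 0 else (i`!%:R)^-1.
Proof. by move=> iN; rewrite coef_poly ltnS iN. Qed.

Lemma coef_exp i : (i <= N)%N -> (1 + expm1)`_i = (i`!%:R)^-1.
Proof.
move=> iN; rewrite coefD coef1 coef_expm1 //; case: i iN => [|i] _ /=.
  by rewrite addr0 fact0 invr1.
by rewrite add0r.
Qed.

Lemma coef_expm1X n m (r : {poly K}) : (m < n)%N -> (expm1 ^+ n * r)`_m = 0.
Proof.
move=> mn; have -> : expm1 = 'X * drop_poly 1 expm1.
  apply/polyP => - [|i]; rewrite coefXM /=; first by rewrite coef_expm1.
  by rewrite coef_drop_poly addn1.
by rewrite exprMn -mulrA coefXnM mn.
Qed.

Lemma sum_expm1 n : (\sum_(k < n) (- expm1) ^+ k) * (1 + expm1) = 1 - (- expm1) ^+ n.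
Proof.
rewrite -[RHS]opprB subrX1 mulrC -mulNr opprB opprK addrC.
by congr (_ * _); rewrite addrC.
Qed.

Lemma coef_expm1NX n m (r : {poly K}) : (m < n)%N -> ((- expm1) ^+ n * r)`_m = 0.
Proof. by move=> mn; rewrite exprNn -mulrA mulrCA coef_expm1X. Qed.

Lemma coef_signM k m (r : {poly K}) : ((-1) ^+ k * r)`_m = (-1) ^+ k * r`_m.
Proof.
rewrite -signr_odd -[in RHS]signr_odd.
by case: (odd k); rewrite ?expr0 ?mul1r // expr1 !mulN1r coefN.
Qed.

Definition log_coef k : K := if k is k'.+1 then (-1) ^+ k' / k'.+1%:R else 0.

(** This is log(1 + (exp(t) - 1)) = t. After differentiation, and since [expm1] has derivative 1 +
    [expm1] in the orders involved, a geometric sum telescopes to 1. *)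
Lemma sum_log_coef n : (n <= N)%N ->
  \sum_(k < n.+1) log_coef k * (expm1 ^+ k)`_n = (n == 1)%:R.
Proof.
case: n => [|n] nN.
  by rewrite big_ord1 mul0r.
apply: (mulfI (natr_neq0 n)); rewrite big_ord_recl mul0r add0r mulr_sumr.
transitivity ((\sum_(k < n.+1) (- expm1) ^+ k * (1 + expm1))`_n).
  rewrite coef_sum; apply: eq_bigr => k _.
  have -> : n.+1%:R * (log_coef (lift ord0 k) * (expm1 ^+ lift ord0 k)`_n.+1)
    = log_coef (lift ord0 k) * ((expm1 ^+ k.+1)^`())`_n.
    by rewrite coef_deriv mulrCA mulr_natl.
  rewrite deriv_exp coefMn -[_`_n *+ _]mulr_natl /= mulrA divfK ?natr_neq0 //.
  rewrite [(- expm1) ^+ _]exprNn -mulrA coef_signM.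
  congr (_ * _); rewrite mulrC !coefM; apply: eq_bigr => i _.
  have := ltn_ord i => ik.
  rewrite coef_exp ?coef_deriv ?coef_expm1; [|lia|lia] => /=.
  congr (_ * _).
  by rewrite factS natrM invfM -[LHS]mulr_natl mulrA divff ?natr_neq0 ?mul1r.
rewrite -mulr_suml sum_expm1 coefB -[(- expm1) ^+ _]mulr1 coef_expm1NX // subr0.
by rewrite coef1; case: n nN => [|n] _; rewrite ?mulr1 ?mulr0.
Qed.

(** The geometric sum inverts 1 + [expm1] modulo t^n, and so does the truncated exp(-t), by the
    binomial expansion of (1 - 1)^i. *)
Lemma sum_expm1X n m : (m < n)%N -> (n <= N)%N ->
  \sum_(k < n) (-1) ^+ k * (expm1 ^+ k)`_m = (-1) ^+ m / m`!%:R.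
Proof.
move=> mn nN; pose g : {poly K} := \poly_(i < N.+1) ((-1) ^+ i / i`!%:R).
pose S := \sum_(k < n) (- expm1) ^+ k.
have gE i : (i <= N)%N -> (g * (1 + expm1))`_i = (i == 0%N)%:R.
  move=> iN; rewrite coefM.
  transitivity ((i`!%:R)^-1 * (1 - 1) ^+ i : K); last first.
    by rewrite subrr expr0n; case: i iN => [|i] _; rewrite ?mulr0 // fact0 invr1 mulr1.
  rewrite exprDn mulr_sumr; apply: eq_bigr => j _.
  have ji : (j <= i)%N by rewrite -ltnS.
  rewrite coef_poly coef_exp ?(leq_trans (leq_subr _ _)) //.
  rewrite ltnS (leq_trans ji iN) expr1n mul1r -mulrA -binr_fact //.
  rewrite -[((-1) ^+ j) *+ _]mulr_natl.
  by rewrite [RHS]mulrA [LHS]mulrC [in RHS](mulrC _ (_%:R)).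
transitivity (S`_m).
  rewrite coef_sum; apply: eq_bigr => k _; rewrite [(- expm1) ^+ _]exprNn.
  by rewrite coef_signM.
transitivity ((S * (g * (1 + expm1)))`_m).
  rewrite coefM (bigD1 (Ordinal (ltnSn m))) //= subnn gE // mulr1.
  rewrite big1 ?addr0 // => i; rewrite -val_eqE /= => im.
  rewrite gE; last by lia.
  by rewrite (_ : (m - i == 0)%N = false) ?mulr0 //; have := ltn_ord i; lia.
rewrite mulrCA sum_expm1 mulrBr mulr1 coefB mulrC coef_expm1NX // subr0.
by rewrite coef_poly (_ : (m < N.+1)%N) //; lia.
Qed.

End ExponentialSeries.

(** * The automorphism E^co *)

Section ExponentialAutomorphism.
Variables (K : fieldType) (U : int -> lmodType K).
Implicit Types (w : seq (letter U)) (D : {linear SymAlg U -> SymAlg U}).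
Local Notation S2U := (SymAlg (gsym U)).
Local Notation copl := (fun y : letter (gsym U) => cop (lval y)).
Local Notation iota1 w := (word (V := gsym U) true [:: wlet w]).

Lemma Eco_letterE N (x : letter (gsym U)) n : (n <= N)%N ->
  Eco_letter copl x n = (expm1 K N)`_n *: Ipow n (lval x).
Proof.
by move=> nN; rewrite coef_expm1 //; case: n nN => [|n] _ /=;
  rewrite ?scale0r // tens_sym_iter_cop.
Qed.

Lemma Eco_letter_linear n : letter_linear (fun x => Eco_letter copl x n).
Proof.
move=> d a u v; rewrite !(Eco_letterE _ (leqnn n)) lval_linear linearP.
by rewrite scalerDr !scalerA mulrC.
Qed.

Lemma Eco_letter_dcomp n x : Eco_letter copl x n \in dcomp (ldeg x).
Proof. by rewrite (Eco_letterE _ (leqnn n)); apply/rpredZ/Ipow_dcomp/lval_dcomp. Qed.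

Lemma Eco_word_cons x v n :
  Eco_word copl (x :: v) n
  = \sum_(i < n.+1) Eco_letter copl x i * Eco_word copl v (n - i).
Proof. by []. Qed.

Lemma triangle_sum (M : nmodType) n (G : nat -> nat -> M) :
  \sum_(i < n.+1) \sum_(j < (n - i).+1) G i j
  = \sum_(i < n.+1) \sum_(j < n.+1 | (i + j <= n)%N) G i j.
Proof.
apply: eq_bigr => i _; have := ltn_ord i => ik.
rewrite (big_ord_widen_cond n.+1 xpredT (G i)); last by lia.
by apply: eq_bigl => j; lia.
Qed.

Lemma compat_Eco_word n : compat true (fun v => Eco_word copl v n).
Proof.
split=> [w1 w2 d a u v|_ w1 w2 x y].
  elim: w1 n => [|z w1 IH] n; rewrite !Eco_word_cons scaler_sumr -big_split;
    apply: eq_bigr => i _ /=.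
    by rewrite Eco_letter_linear mulrDl -scalerAl.
  by rewrite IH mulrDr -scalerAr.
elim: w1 n => [|z w1 IH] n; last first.
  rewrite !Eco_word_cons scaler_sumr; apply: eq_bigr => i _ /=.
  by rewrite IH -scalerAr.
have EE (a b : letter (gsym U)) : Eco_word copl [:: a, b & w2] n
   = \sum_(i < n.+1) \sum_(j < n.+1 | (i + j <= n)%N)
       Eco_letter copl a i * Eco_letter copl b j * Eco_word copl w2 (n - (i + j)).
  rewrite -(triangle_sum n (fun i j =>
    Eco_letter copl a i * Eco_letter copl b j * Eco_word copl w2 (n - (i + j)))).
  rewrite Eco_word_cons; apply: eq_bigr => i _.
  rewrite Eco_word_cons mulr_sumr; apply: eq_bigr => j _.
  by rewrite mulrA subnDA.
rewrite !EE.
rewrite (exchange_big_dep xpredT) //= scaler_sumr; apply: eq_bigr => j _.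
rewrite scaler_sumr; apply: eq_big => [i|i _]; first by rewrite addnC.
rewrite (dcomp_mulC (Eco_letter_dcomp i x) (Eco_letter_dcomp j y)) -scalerAl.
by rewrite addnC.
Qed.

(** The component of order n of E^co on the uncompleted S(S(U)). *)
Definition Theta n : S2U -> S2U := wext (compat_Eco_word n).
HB.instance Definition _ n := GRing.Linear.on (Theta n).

Lemma Theta1 n : Theta n 1 = (n == 0%N)%:R.
Proof. by rewrite /Theta -[1]/(word true [::]) wextE. Qed.

Lemma Theta_sym_inj_mul N n (z : SymAlg U) (t : S2U) : (n <= N)%N ->
  Theta n (sym_inj z * t)
  = \sum_(i < n.+1) (expm1 K N)`_i *: (Ipow i z * Theta (n - i) t).
Proof.
move=> nN; elim/walg_ind: z => [|a x y hx hy|w].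
- by rewrite linear0 mul0r linear0 big1 // => i _; rewrite linear0 mul0r scaler0.
- rewrite linearP mulrDl -scalerAl linearP /= hx hy scaler_sumr -big_split.
  apply: eq_bigr => i _ /=.
  by rewrite linearP mulrDl -scalerAl scalerDr !scalerA mulrC.
rewrite sym_inj_word; elim/walg_ind: t => [|a x y hx hy|v].
- by rewrite mulr0 linear0 big1 // => i _; rewrite linear0 mulr0 scaler0.
- rewrite mulrDr -scalerAr linearP /= hx hy scaler_sumr -big_split.
  apply: eq_bigr => i _ /=.
  by rewrite linearP mulrDr -scalerAr scalerDr !scalerA mulrC.
rewrite -word_cat /Theta wextE Eco_word_cons; apply: eq_bigr => i _.
have := ltn_ord i => ik.
by rewrite wextE (Eco_letterE (N := N)) ?scalerAl //; lia.
Qed.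

(** E^co is multiplicative and maps iota to exp(iota) - 1, so it maps iota^k to (exp(iota) - 1)^k, a
    series in the powers of iota. *)
Lemma Theta_ipow N k n w : (n <= N)%N ->
  Theta n (ipow k w) = (expm1 K N ^+ k)`_n *: ipow n w.
Proof.
elim: k n w => [|k IH] n w nN.
  rewrite /= expr0 coef1; case: n nN => [|n] _ /=.
    by case: (w == [::]); rewrite ?mulr0n ?mulr1n ?linear0 ?Theta1 ?scaler0 ?scale1r.
  by case: (w == [::]); rewrite ?mulr0n ?mulr1n ?linear0 ?Theta1 scale0r.
rewrite [ipow _ _]/= unsh_linear exprS coefM scaler_suml.
transitivity (unsh (fun a b => \sum_(i < n.+1) 
   ((expm1 K N)`_i * (expm1 K N ^+ k)`_(n - i)) *: (ipow i a * ipow (n - i) b)) w).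
  apply: eq_unsh => a b; rewrite /= -sym_inj_word (Theta_sym_inj_mul _ _ nN).
  apply: eq_bigr => i _; rewrite IH; last by lia.
  by rewrite Ipow_word -scalerAr scalerA.
rewrite unsh_sum; apply: eq_bigr => i _.
by rewrite unshZ -ipowD subnKC // -ltnS.
Qed.

Definition dterm D i j w : S2U :=
  unsh (fun a b => Ipow i (D (word true a)) * ipow j b) w.

Lemma Theta_dconv N D k n w : (n <= N)%N ->
  Theta n (dconv D k w)
  = \sum_(i < n.+1) ((expm1 K N)`_i * (expm1 K N ^+ k)`_(n - i)) *: dterm D i (n - i) w.
Proof.
move=> nN; rewrite unsh_linear.
transitivity (unsh (fun a b => \sum_(i < n.+1) 
   ((expm1 K N)`_i * (expm1 K N ^+ k)`_(n - i)) *: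
     (Ipow i (D (word true a)) * ipow (n - i) b)) w).
  apply: eq_unsh => a b; rewrite /= (Theta_sym_inj_mul _ _ nN).
  apply: eq_bigr => i _; rewrite (Theta_ipow (N := N)); last by lia.
  by rewrite -scalerAr scalerA.
by rewrite unsh_sum; apply: eq_bigr => i _; rewrite unshZ.
Qed.

Lemma EcoE f n : Eco copl f n = \sum_(k < n.+1) Theta n (f k).
Proof. by []. Qed.

Lemma Eco_word_head v : Eco_word copl v (size v) = word true v.
Proof.
have Eco_word_small u n : (n < size u)%N -> Eco_word copl u n = 0.
  elim: u n => // x u IH n nu; rewrite Eco_word_cons big1 // => - [[|i] ik] _.
    by rewrite /= mul0r.
  by rewrite IH ?mulr0 //=; move: nu ik => /=; lia.
elim: v => [|x v IH] //.
rewrite Eco_word_cons big_ord_recl /= mul0r add0r big_ord_recl /=.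
rewrite big1 ?addr0 => [|i _].
  rewrite subSS subn0 IH invr1 scale1r /tens_sym wliftE.
    by rewrite -word_cat.
  by split=> // *; apply: word_lin.
by rewrite Eco_word_small ?mulr0 // /bump; have := ltn_ord i; lia.
Qed.

Lemma Theta_top n z : z \in lcomp n -> Theta n z = z.
Proof.
move=> /eqP <-; elim/walg_ind: z => [|a x y hx hy|v]; first by rewrite !linear0.
  by rewrite !linearP /= hx hy.
rewrite lproj_word; case: eqP => [<-|_]; rewrite ?linear0 //.
by rewrite /Theta wextE Eco_word_head.
Qed.

(** E^co is unitriangular for the length by [Theta_top]. Injectivity is what identifies [Lco],
    defined by choosing a preimage. *)
Lemma Eco_inj f g : Shat f -> Shat g -> Eco copl f = Eco copl g -> f = g.
Proof.
move=> fS gS Efg; apply: funext => n.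
have [m] := ubnP n; elim: m n => // m IH n nm.
have := congr1 (fun h => h n) Efg; rewrite !EcoE !big_ord_recr /=.
rewrite (Theta_top (fS n)) (Theta_top (gS n)).
rewrite (eq_bigr (fun k : 'I_n => Theta n (g k))) => [|k _]; first exact: addrI.
by rewrite IH //; have := ltn_ord k; lia.
Qed.

Hypothesis charK0 : [pchar K] =i pred0.

(** The components of log(1 + iota) at y, which turn out to be L^co(y) for homogeneous y. *)
Definition Lseq (y : SymAlg U) (k : nat) : S2U := log_coef K k *: Ipow k y.

Lemma Lseq_linear k : linear (Lseq^~ k).
Proof. by move=> a x y; rewrite /Lseq linearP scalerDr !scalerA mulrC. Qed.

Lemma Eco_Lseq x : Eco copl (Lseq (lval x)) = hat_letter x.
Proof.
apply: funext => n; rewrite EcoE /hat_letter -sym_inj_lval.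
transitivity ((n == 1%N)%:R *: sym_inj (lval x)); last first.
  by case: (n == 1%N); rewrite ?scale1r ?scale0r.
elim/walg_ind: (lval x) => [|a y z hy hz|w].
- by rewrite !linear0 big1 // => k _; rewrite /Lseq !linear0.
- rewrite linearP scalerDr scalerA mulrC -scalerA -hy -hz scaler_sumr -big_split.
  by apply: eq_bigr => k _; rewrite Lseq_linear linearP.
transitivity (\sum_(k < n.+1) (log_coef K k * (expm1 K n ^+ k)`_n) *: ipow n w).
  apply: eq_bigr => k _; rewrite /Lseq linearZ /= Ipow_word.
  by rewrite (Theta_ipow (N := n)) // scalerA.
rewrite -scaler_suml sum_log_coef // sym_inj_word -ipow1.
by case: eqP => [->//|_]; rewrite !scale0r.
Qed.

Lemma Lseq_Shat y : Shat (Lseq y).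
Proof.
move=> k; have /eqP h := Ipow_lcomp k y.
by apply/eqP; rewrite /Lseq linearZ /= h.
Qed.

Lemma Lco_letter x : Lco copl (hat_letter x) = Lseq (lval x).
Proof.
have h : [set f : nat -> S2U | Shat f /\ Eco copl f = hat_letter x]%classic
    (Lseq (lval x)).
  by split; [exact: Lseq_Shat|exact: Eco_Lseq].
by apply: (xget_unique _ h) => f [fS fE]; apply: Eco_inj => //;
  [exact: Lseq_Shat|rewrite Eco_Lseq].
Qed.

Definition cobracket_term D n w : S2U :=
  \sum_(i < n.+1) ((expm1 K n)`_i * ((-1) ^+ (n - i) / (n - i)`!%:R)) *:
    dterm D i (n - i) w.

Lemma compat_cobracket_term D n : compat true (cobracket_term D n).
Proof.
have cd i : compat true (dterm D i (n - i)).
  apply: compat_unsh => b; last exact/compat_mull/compat_ipow.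
  apply: compat_mulr.
  exact: (compat_linear (Ipow i \o D) (compat_word U true)).
split=> [w1 w2 d a u v|hc w1 w2 x y]; rewrite /cobracket_term scaler_sumr.
  rewrite -big_split; apply: eq_bigr => i _ /=.
  by rewrite (cd i).1 scalerDr !scalerA mulrC.
by apply: eq_bigr => i _; rewrite (cd i).2 // !scalerA mulrC.
Qed.

(** The derivation turns log(1 + iota) into the sum of (-1)^k (iota o D) * iota^k, that is, (iota o
    D) * (1 + iota)^(-1); E^co then replaces iota by exp(iota) - 1. *)
Lemma sym_cobracketE D p n x : has_degree p D ->
  sym_cobracket p D n x = wlift (cobracket_term D n) (lval x).
Proof.
move=> Dp; rewrite /sym_cobracket /koszul_cobracket Lco_letter EcoE /der.
under eq_bigr => k _ do rewrite -(dextE Dp).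
rewrite -/(wext (compat_cobracket_term D n) _).
elim/walg_ind: (lval x) => [|a y z hy hz|w].
- by rewrite linear0 big1 // => k _; rewrite /Lseq !linear0.
- rewrite [RHS]linearP /= -hy -hz scaler_sumr -big_split /=; apply: eq_bigr => k _.
  by rewrite Lseq_linear !linearP.
rewrite wextE /cobracket_term big_ord_recl /Lseq scale0r !linear0 add0r.
transitivity (\sum_(k < n) \sum_(i < n.+1)
    ((-1) ^+ k * ((expm1 K n)`_i * (expm1 K n ^+ k)`_(n - i))) *: dterm D i (n - i) w).
  apply: eq_bigr => k _; rewrite Ipow_word linearZ /= dext_ipow scalerA.
  rewrite divfK ?natr_neq0 // linearZ /= (Theta_dconv (N := n)) // scaler_sumr.
  by apply: eq_bigr => i _; rewrite scalerA.
rewrite exchange_big; apply: eq_bigr => i _; rewrite -scaler_suml; congr (_ *: _).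
(* The geometric sum over k < n is exact only in orders below n, hence for i > 0; for i = 0 the
   coefficient of [expm1] is 0. *)
case: (posnP i) => [->|i0].
  by rewrite coef_expm1 // mul0r big1 // => k _; rewrite mul0r mulr0.
have := ltn_ord i => ik.
rewrite -(sum_expm1X charK0 (m := n - i) _ (leqnn n)); last by lia.
by rewrite mulr_sumr; apply: eq_bigr => k _; rewrite mulrCA.
Qed.

End ExponentialAutomorphism.

(** * Projection onto the generators *)

Section CobracketTerms.
Variables (K : fieldType) (U : int -> lmodType K).
Hypothesis charK0 : [pchar K] =i pred0.
Implicit Types (w : seq (letter U)) (D : {linear SymAlg U -> SymAlg U}).
Local Notation S2U := (SymAlg (gsym U)).
Local Notation iota1 w := (word (V := gsym U) true [:: wlet w]).

Lemma Ipow0 (z : SymAlg U) : Ipow 0 z = (counit z)%:A.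
Proof.
have cl := wlift_linear (compat_aug U true); rewrite /counit.
elim/walg_ind: z => [|a x y hx hy|w].
- by rewrite (linear_fun0 cl) linear0 scale0r.
- by rewrite linearP /= hx hy cl scalerDl scalerA.
rewrite Ipow_word wliftE; last exact: compat_aug.
by rewrite /=; case: (w == [::]); rewrite ?scale1r ?scale0r.
Qed.

Lemma cobracket_term_bin D n w : (forall z, counit (D z) = 0) ->
  n`!%:R *: cobracket_term D n w
  = \sum_(i < n.+1) ('C(n, i)%:R * (-1) ^+ (n - i)) *: dterm D i (n - i) w.
Proof.
move=> D0; rewrite /cobracket_term scaler_sumr; apply: eq_bigr => i _.
have i_n : (i <= n)%N by rewrite -ltnS.
(* At i = 0 the coefficient is 0 on the left and +/- 1 on the right, but iota^0 o D = 0 because the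
   counit kills the values of D. *)
rewrite scalerA coef_expm1 //; case: eqP => [->|i0].
  suff -> : dterm D 0 (n - 0) w = 0 by rewrite !scaler0.
  rewrite -[RHS](unsh0 _ w); apply: eq_unsh => a b.
  by rewrite Ipow0 D0 scale0r mul0r.
congr (_ *: _); have := binr_fact charK0 i_n; have := fact_neq0 charK0 n.
move=> nf /(canRL (divfK nf)) ->.
set a := (i`!%:R)^-1; set b := (_^-1 : K); set c := (-1) ^+ _; set d := n`!%:R.
by ring.
Qed.

Lemma word_cons_mul (x : letter U) w :
  word true (x :: w) = word true [:: x] * word true w.
Proof. by rewrite -word_cat. Qed.

Lemma lproj_word_cons k (x : letter U) w :
  lproj k.+1 (word true (x :: w)) = word true [:: x] * lproj k (word true w).
Proof.
by rewrite !lproj_word /= eqSS; case: eqP; rewrite ?mulr0 // -word_cons_mul.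
Qed.

Lemma lproj_dcomp k d (x : SymAlg U) : x \in dcomp d -> lproj k x \in dcomp d.
Proof.
move: x; apply: dcomp_ind => [|a x y hx hy|w <-]; first by rewrite linear0 rpred0.
  by rewrite linearP; apply: rpredD => //; apply: rpredZ.
by rewrite lproj_word; case: ifP; rewrite ?rpred0 ?word_dcomp.
Qed.

Lemma unsh_lproj i j w :
  unsh (fun a b => lproj i (word true a) * lproj j (word true b)) w
  = 'C(i + j, i)%:R *: lproj (i + j) (word true w).
Proof.
elim: w i j => [|x w IH] i j /=.
  rewrite !lproj_word /=; case: i => [|i]; last by rewrite mul0r scaler0.
  by case: j => [|j]; rewrite ?mulr0 ?scaler0 // mulr1 scale1r.
have lproj0 v : lproj 0 (word true (x :: v)) = 0 by rewrite lproj_word.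
have h1 : unsh (fun a b => lproj i (word true (x :: a)) * lproj j (word true b)) w
   = (if i is i'.+1 then 'C(i' + j, i')%:R else 0) *:
      (word true [:: x] * lproj (i + j).-1 (word true w)).
  case: i => [|i].
    rewrite scale0r -[RHS](unsh0 _ w); apply: eq_unsh => a b.
    by rewrite lproj0 mul0r.
  rewrite addSn scalerAr -IH -unsh_mull; apply: eq_unsh => a b.
  by rewrite lproj_word_cons mulrA.
have h2 : unsh (fun a b => (-1) ^ (ldeg x * wdeg a) *:
      (lproj i (word true a) * lproj j (word true (x :: b)))) w
   = (if j is j'.+1 then 'C(i + j', i)%:R else 0) *:
      (word true [:: x] * lproj (i + j).-1 (word true w)).
  case: j {h1} => [|j].
    rewrite scale0r -[RHS](unsh0 _ w); apply: eq_unsh => a b.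
    by rewrite lproj0 mulr0 scaler0.
  rewrite addnS scalerAr -IH -unsh_mull; apply: eq_unsh => a b.
  have ad := lproj_dcomp i (word_dcomp true a).
  rewrite lproj_word_cons !mulrA (dcomp_mulC ad (letter_dcomp true x)).
  by rewrite -scalerAl scalerA mulrC [ldeg x * _]mulrC sgn_sqr scale1r.
rewrite h1 h2 -scalerDl; case: i h1 h2 => [|i] _ _; case: j => [|j].
- by rewrite add0r scale0r lproj0 scaler0.
- by rewrite add0r !add0n !bin0 lproj_word_cons.
- by rewrite addr0 !addn0 !binn lproj_word_cons.
by rewrite (addSnnS i j) addSn lproj_word_cons binS natrD [X in X *: _]addrC.
Qed.

(** * The algebra morphism from S(S(U)) to S(U) induced by the projection of S(U) onto U *)

Section Projection.

Let proj_word (v : seq (letter (gsym U))) : SymAlg U :=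
  \prod_(y <- v) lproj 1 (lval y).

Let compat_proj_word : compat true proj_word.
Proof.
split=> [w1 w2 d a u v|_ w1 w2 x y]; rewrite /proj_word !big_cat !big_cons /=.
  by rewrite lval_linear linearP mulrDl mulrDr -scalerAl -scalerAr.
have h z := lproj_dcomp 1 (lval_dcomp z).
rewrite (mulrA (lproj 1 (lval x))) (dcomp_mulC (h x) (h y)) -scalerAl -scalerAr.
by rewrite -mulrA.
Qed.

Definition lproj1_ext : S2U -> SymAlg U := wext compat_proj_word.
HB.instance Definition _ := GRing.Linear.on lproj1_ext.

Lemma lproj1_extM x y : lproj1_ext (x * y) = lproj1_ext x * lproj1_ext y.
Proof.
elim/walg_ind: x => [|a x x' hx hx'|v]; first by rewrite !(mul0r, linear0).
  by rewrite mulrDl -scalerAl !linearP /= hx hx' mulrDl -scalerAl.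
elim/walg_ind: y => [|a y y' hy hy'|v']; first by rewrite !(mulr0, linear0).
  by rewrite mulrDr -scalerAr !linearP /= hy hy' mulrDr -scalerAr.
by rewrite -word_cat /lproj1_ext !wextE /proj_word big_cat.
Qed.

Lemma lproj1_ext_letter y : lproj1_ext (word true [:: y]) = lproj 1 (lval y).
Proof. by rewrite /lproj1_ext wextE /proj_word big_seq1. Qed.

End Projection.

Lemma lproj1_ext_ipow k w :
  lproj1_ext (ipow k w) = k`!%:R *: lproj k (word true w).
Proof.
elim: k w => [|k IH] w.
  rewrite fact0 scale1r lproj_word /=; case: w => [|x w] /=; last by rewrite linear0.
  by rewrite /lproj1_ext -[1]/(word true [::]) wextE big_nil.
rewrite [ipow _ _]/= unsh_linear.
transitivity (k`!%:R *:
    unsh (fun a b => lproj 1 (word true a) * lproj k (word true b)) w).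
  rewrite -unshZ; apply: eq_unsh => a b.
  by rewrite /= lproj1_extM lproj1_ext_letter IH -scalerAr.
by rewrite unsh_lproj add1n bin1 scalerA factS mulnC natrM.
Qed.

Lemma lproj1_ext_Ipow k z : lproj1_ext (Ipow k z) = k`!%:R *: lproj k z.
Proof.
elim/walg_ind: z => [|a x y hx hy|w]; first by rewrite !(linear0, scaler0).
  by rewrite !linearP /= hx hy.
by rewrite Ipow_word lproj1_ext_ipow.
Qed.

(** With p_j the projection onto S^j(U), the cobracket is mapped to the sum of (-1)^j (p_i o D) *
    p_j over i + j = n, and s is the sum of the (-1)^j p_j. *)
Lemma lproj_convs D n w : (forall z, counit (D z) = 0) ->
  lproj n (convs D w) = lproj1_ext (cobracket_term D n w).
Proof.
move=> D0; apply: (scalerI (fact_neq0 charK0 n)).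
rewrite -[RHS]linearZ /= cobracket_term_bin // linear_sum /=.
rewrite unsh_linear -unshZ.
transitivity (unsh (fun a b => \sum_(i < n.+1)
   (n`!%:R * (-1) ^+ size b) *:
     (lproj i (D (word true a)) * lproj (n - i) (word true b))) w).
  apply: eq_unsh => a b.
  by rewrite /= linearZ /= lprojM scalerA scaler_sumr.
rewrite unsh_sum; apply: eq_bigr => i _; rewrite linearZ /= unsh_linear -unshZ.
apply: eq_unsh => a b; rewrite /= lproj1_extM lproj1_ext_Ipow lproj1_ext_ipow.
(* Only words b of length n - i survive, for which the two signs agree. *)
rewrite -scalerAl -scalerAr !scalerA lproj_word; case: eqP => [->|_].
  congr (_ *: _); rewrite -(bin_fact (_ : i <= n)%N) ?natrM; last by rewrite -ltnS.
  by ring.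
by rewrite !mulr0 !scaler0.
Qed.

End CobracketTerms.

(** * Vanishing of the cobrackets *)

Section CobracketVanishing.
Variables (K : fieldType) (U : int -> lmodType K).
Hypothesis charK0 : [pchar K] =i pred0.
Implicit Types (w : seq (letter U)) (D : {linear SymAlg U -> SymAlg U}).
Local Notation S2U := (SymAlg (gsym U)).
Local Notation iota1 w := (word (V := gsym U) true [:: wlet w]).

(** The letter x lies in one of the k factors, and by graded cocommutativity that factor can be put
    first. *)
Lemma ipow_cons k x w :
  ipow k (x :: w)
  = k%:R *: unsh (fun a b => iota1 (x :: a) * ipow k.-1 b) w :> S2U.
Proof.
elim: k w => [|k IH] w; first by rewrite scale0r.
rewrite [LHS]/= [in RHS]mulrS [in RHS]addrC scalerDl scale1r addrC; congr (_ + _).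
case: k IH => [|k] IH.
  by rewrite scale0r -[RHS](unsh0 _ w); apply: eq_unsh => a b; rewrite mulr0 scaler0.
transitivity (k.+1%:R *: unsh (fun a b => unsh (fun b1 b2 =>
    (-1) ^ (ldeg x * wdeg a) *: (iota1 a * (iota1 (x :: b1) * ipow k b2))) b) w).
  rewrite -unshZ; apply: eq_unsh => a b.
  by rewrite unshZ unsh_mull IH -scalerAr !scalerA mulrC.
rewrite -unshA; congr (_ *: _).
transitivity (unsh (fun a b => unsh (fun a1 a2 =>
    iota1 (x :: a1) * (iota1 a2 * ipow k b)) a) w); last first.
  by rewrite unshA; apply: eq_unsh => a b; rewrite unsh_mull.
apply: eq_unsh => a b; rewrite unshC; apply: eq_unsh => a1 a2.
have h1 := letter_dcomp true (wlet (x :: a1)); have h2 := letter_dcomp true (wlet a2).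
rewrite ldeg_wlet wdeg_cons in h1; rewrite ldeg_wlet in h2.
rewrite !mulrA (dcomp_mulC h2 h1) -scalerAl !scalerA -!sgnD.
rewrite (_ : _ + _ = 2 * (wdeg a1 * wdeg a2 + ldeg x * wdeg a2)); last by ring.
by rewrite sgn_double scale1r.
Qed.

(* Each letter of v is absorbed by one of the i factors: a twisted Leibniz     *)
(* rule, where q counts the factors that absorb at least one letter.           *)
Lemma ipow_cat v : exists Q : nat -> seq (letter U) -> S2U,
  (forall q w, (size v < q)%N -> Q q w = 0) /\
  forall i w, ipow i (v ++ w)
    = \sum_(q < (size v).+1) (i ^_ q)%:R *: unsh (fun a b => Q q a * ipow (i - q) b) w.
Proof.
elim/last_ind: v => [|v x [Q [Q0 QE]]].
  exists (fun q => if q is 0%N then ipow 0 else fun=> 0); split=> [[]//|i w].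
  by rewrite big_ord1 ffactn0 scale1r subn0 -ipowD.
(* Either x joins a factor already met by v, which is the term Q q (x :: a), or it enters one of the
   i - q others, which is B; then i^_q (i - q) = i^_(q + 1). *)
pose B q a := unsh (fun a1 a2 =>
    (-1) ^ (ldeg x * wdeg a1) *: (Q q a1 * iota1 (x :: a2))) a.
exists (fun q a => Q q (x :: a) + if q is q'.+1 then B q' a else 0); split=> [q a|i w].
  rewrite size_rcons => vq; rewrite Q0 ?add0r; last by lia.
  case: q vq => // q vq; rewrite -[RHS](unsh0 _ a); apply: eq_unsh => a1 a2.
  by rewrite Q0 ?mul0r ?scaler0.
rewrite cat_rcons QE size_rcons.
transitivity (\sum_(q < (size v).+1)
    ((i ^_ q)%:R *: unsh (fun a b => Q q (x :: a) * ipow (i - q) b) w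
     + (i ^_ q.+1)%:R *: unsh (fun a b => B q a * ipow (i - q.+1) b) w)).
  apply: eq_bigr => q _; rewrite [unsh _ (x :: w)]/= scalerDr; congr (_ + _).
  rewrite ffactnSr natrM -scalerA; congr (_ *: _).
  transitivity ((i - q)%:R *: unsh (fun a b => unsh (fun b1 b2 =>
      (-1) ^ (ldeg x * wdeg a) *: (Q q a * (iota1 (x :: b1) * ipow (i - q.+1) b2))) b) w).
    rewrite -unshZ; apply: eq_unsh => a b.
    by rewrite ipow_cons unshZ unsh_mull -scalerAr !scalerA mulrC subnS.
  rewrite -unshA; congr (_ *: _); apply: eq_unsh => a b; rewrite -unsh_mulr.
  by apply: eq_unsh => a1 a2; rewrite -scalerAl mulrA.
rewrite big_split.
transitivity (
  \sum_(q < (size v).+2) (i ^_ q)%:R *: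
      unsh (fun a b => Q q (x :: a) * ipow (i - q) b) w
  + \sum_(q < (size v).+2) (i ^_ q)%:R *: unsh (fun a b =>
      (if val q is q'.+1 then B q' a else 0) * ipow (i - q) b) w).
  congr (_ + _).
    rewrite [RHS]big_ord_recr /= [X in _ = _ + X](_ : _ = 0) ?addr0 //.
    rewrite (_ : unsh _ _ = 0) ?scaler0 // -[RHS](unsh0 _ w).
    by apply: eq_unsh => a b; rewrite Q0 ?mul0r.
  rewrite [RHS]big_ord_recl /= [X in _ = X + _](_ : _ = 0) ?add0r //.
  by rewrite ffactn0 scale1r -[RHS](unsh0 _ w); apply: eq_unsh => a b; rewrite mul0r.
rewrite -big_split; apply: eq_bigr => q _; rewrite /= -scalerDr -unshD; congr (_ *: _).
by apply: eq_unsh => a b; rewrite mulrDl.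
Qed.

(** The n-th finite difference at 0 of a polynomial of degree q < n; i C(n, i) = n C(n - 1, i - 1)
    lowers both n and q. *)
Lemma sum_bin_ffact (q n : nat) : (q < n)%N ->
  \sum_(i < n.+1) 'C(n, i)%:R * (-1) ^+ (n - i) * (i ^_ q)%:R = 0 :> K.
Proof.
elim: q n => [|q IH] [|n] // qn.
  transitivity ((-1 + 1) ^+ n.+1 : K); last by rewrite addNr expr0n.
  rewrite exprDn; apply: eq_bigr => i _.
  by rewrite expr1n mulr1 ffactn0 mulr1 mulr_natl.
rewrite big_ord_recl mulr0 add0r; have {}IH := IH n qn.
transitivity (n.+1%:R *
    (\sum_(i < n.+1) 'C(n, i)%:R * (-1) ^+ (n - i) * (i ^_ q)%:R) : K);
  last by rewrite IH mulr0.
rewrite mulr_sumr.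
apply: eq_bigr => i _; rewrite lift0 subSS ffactnS /= natrM.
have := mul_bin_diag n.+1 i => /(congr1 (fun m : nat => m%:R : K)).
rewrite /= !natrM => h.
by rewrite !mulrA h; ring.
Qed.

Lemma sum_ipow_cat v n w : (size v < n)%N ->
  \sum_(i < n.+1) ('C(n, i)%:R * (-1) ^+ (n - i)) *:
    unsh (fun a b => ipow i (v ++ a) * ipow (n - i) b) w = 0 :> S2U.
Proof.
move=> vn; have [Q [_ QE]] := ipow_cat v.
transitivity (\sum_(i < n.+1) \sum_(q < (size v).+1)
   ('C(n, i)%:R * (-1) ^+ (n - i) * (i ^_ q)%:R) *:
     unsh (fun a b => Q q a * ipow (n - q) b) w).
  apply: eq_bigr => i _.
  transitivity (('C(n, i)%:R * (-1) ^+ (n - i)) *: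
      unsh (fun a b => \sum_(q < (size v).+1) (i ^_ q)%:R *:
        unsh (fun a1 a2 => Q q a1 * (ipow (i - q) a2 * ipow (n - i) b)) a) w).
    congr (_ *: _); apply: eq_unsh => a b; rewrite QE mulr_suml.
    apply: eq_bigr => q _; rewrite -scalerAl -unsh_mulr; congr (_ *: _).
    by apply: eq_unsh => a1 a2; rewrite mulrA.
  rewrite unsh_sum scaler_sumr; apply: eq_bigr => q _; rewrite unshZ scalerA.
  (* For q at most i, iota^(i - q) * iota^(n - i) = iota^(n - q) no longer depends on i; for q > i
     the subtraction is truncated, but i^_q = 0. *)
  case: (leqP q i) => qi; last by rewrite ffact_small // mulr0 !scale0r.
  congr (_ *: _); rewrite unshA; apply: eq_unsh => a b; rewrite unsh_mull.
  congr (_ * _); rewrite -ipowD; congr ipow.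
  by have := ltn_ord i; lia.
rewrite exchange_big big1 // => q _; rewrite -scaler_suml sum_bin_ffact ?scale0r //.
by have := ltn_ord q; lia.
Qed.

(** The antipode identity s * id = unit o counit: the terms with the first letter on the left cancel
    those with it on the right. *)
Lemma antipodeK w :
  unsh (fun a b => (-1) ^+ size a *: (word true a * word true b)) w
  = (w == [::])%:R :> SymAlg U.
Proof.
case: w => [|x w] /=; first by rewrite scale1r mulr1.
rewrite -unshD -[RHS](unsh0 _ w); apply: eq_unsh => a b.
rewrite [word true (x :: a)]word_cons_mul [word true (x :: b)]word_cons_mul mulrA.
rewrite (dcomp_mulC (word_dcomp true a) (letter_dcomp true x)) exprS mulN1r scaleNr.
rewrite -scalerAl !scalerA [wdeg a * _]mulrC [X in _ + X *: _]mulrAC sgn_sqr mul1r.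
by rewrite addNr.
Qed.

Lemma convsK D w :
  D (word true w) = unsh (fun a b => convs D a * word true b) w.
Proof.
transitivity (unsh (fun a b => unsh (fun a1 a2 =>
  D (word true a1) * ((-1) ^+ size a2 *: (word true a2 * word true b))) a) w); last first.
  apply: eq_unsh => a b; rewrite /convs -unsh_mulr; apply: eq_unsh => a1 a2.
  by rewrite -scalerAl -scalerAr mulrA.
rewrite unshA -[LHS](unsh_nilr (fun a _ => D (word true a))); apply: eq_unsh => a b.
by rewrite unsh_mull antipodeK; case: b => [|y b]; rewrite ?mulr1 ?mulr0.
Qed.

Lemma cobracket_term_eq0 D m n w :
  (forall z, counit (D z) = 0) -> (forall v, convs D v \in lle m) ->
  (m < n)%N -> cobracket_term D n w = 0.
Proof.
move=> D0 Dm mn; apply: (scalerI (fact_neq0 charK0 n)).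
rewrite scaler0 cobracket_term_bin //.
transitivity (unsh (fun a c => \sum_(i < n.+1) ('C(n, i)%:R * (-1) ^+ (n - i)) *:
   unsh (fun a2 b => Ipow i (convs D a * word true a2) * ipow (n - i) b) c) w).
  rewrite unsh_sum; apply: eq_bigr => i _; rewrite unshZ -unshA; congr (_ *: _).
  apply: eq_unsh => a b; rewrite convsK unsh_linear -unsh_mulr.
  by [].
(* The sum now depends linearly on the value of phi at a, so this value may be taken to be a word of
   length at most m < n. *)
rewrite -[RHS](unsh0 _ w); apply: eq_unsh => a c.
pose S y : S2U := \sum_(i < n.+1) ('C(n, i)%:R * (-1) ^+ (n - i)) *:
   unsh (fun a2 b => Ipow i (y * word true a2) * ipow (n - i) b) c.
rewrite -/(S (convs D a)); have SP k x y : S (k *: x + y) = k *: S x + S y.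
  rewrite /S scaler_sumr -big_split; apply: eq_bigr => i _ /=.
  set e := 'C(n, i)%:R * _; rewrite (scalerA k e) (mulrC k e) -(scalerA e k).
  rewrite -scalerDr -unshP; congr (_ *: _).
  by apply: eq_unsh => b1 b2; rewrite mulrDl -scalerAl linearP mulrDl -scalerAl.
move: (convs D a) (Dm a); apply: lle_ind => [|k x y hx hy|v vm].
- exact: linear_fun0 SP.
- by rewrite SP hx hy scaler0 addr0.
rewrite -[RHS](sum_ipow_cat (v := v) c (n := n)); last by lia.
apply: eq_bigr => i _; congr (_ *: _); apply: eq_unsh => b1 b2.
by rewrite -word_cat Ipow_word.
Qed.

End CobracketVanishing.

(** * The filtration by word length *)

Section Filtration.
Variables (K : fieldType) (U : int -> lmodType K).
Variables (D : {linear SymAlg U -> SymAlg U}) (p : int) (m : nat).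
Hypotheses (D_deg : has_degree p D) (D1 : D 1 = 0).

Lemma koszul_bracket_letters k (u : 'I_k -> letter U) :
  koszul_bracket D (fun j => wlet [:: u j]) = convs D [seq u j | j <- enum 'I_k].
Proof.
by rewrite koszul_bracketE // -kbracket_letters -map_comp.
Qed.

Lemma convs_lle_letters :
  (forall w, convs D w \in lle m) <->
  (forall k (u : 'I_k -> letter U), (1 <= k)%N ->
     koszul_bracket D (fun j => wlet [:: u j]) \in lle m).
Proof.
split=> [h k u _|h w]; first by rewrite koszul_bracket_letters.
(* The empty word is not reached by k >= 1; there phi takes the value D 1 = 0. *)
case: w => [|x w].
  by rewrite /convs /= -[word true [::]]/(1 : SymAlg U) D1 mul0r scaler0 rpred0.
have := h _ (tnth (in_tuple (x :: w))) isT.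
by rewrite koszul_bracket_letters map_tnth_enum.
Qed.

Lemma koszul_bracket_lle k (i : 'I_k -> nat) (x : 'I_k -> letter (gsym U)) :
  (forall w, convs D w \in lle m) -> (forall j, (1 <= i j)%N) ->
  (forall j, lval (x j) \in lle (i j)) ->
  koszul_bracket D x \in lle ((\sum_(j < k) i j) - k + m)%N.
Proof.
move=> Dm i1 xi; rewrite koszul_bracketE //.
have := kbracket_lle (enum 'I_k) D_deg Dm xi; congr (_ \in lle _).
rewrite big_enum /= addnC; congr (_ + _)%N.
(* As every i_j is positive, the truncated subtraction of k is exact. *)
rewrite [in RHS](eq_bigr (fun j => (i j).-1 + 1)%N) => [|j _].
  by rewrite big_split sum_nat_const card_ord muln1 addnK; apply: eq_bigl.
by rewrite addn1 prednK.
Qed.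

Lemma convs_lle_cobracket : [pchar K] =i pred0 -> (forall z, counit (D z) = 0) ->
  (forall w, convs D w \in lle m) <->
  (forall n x, (m < n)%N -> sym_cobracket p D n x = 0).
Proof.
move=> charK0 D0; split=> [h n x mn|h w].
  rewrite (sym_cobracketE charK0) // -/(wext (compat_cobracket_term D n) _).
  elim/walg_ind: (lval x) => [|a y z hy hz|w]; first by rewrite linear0.
    by rewrite linearP /= hy hz scaler0 addr0.
  by rewrite wextE (cobracket_term_eq0 charK0 _ D0 h).
apply/lleP => n mn; rewrite (lproj_convs charK0) //.
have := h n (wlet w) mn; rewrite (sym_cobracketE charK0) // lval_wlet.
by rewrite wliftE ?linear0 => [->|]; [rewrite linear0|exact: compat_cobracket_term].
Qed.

End Filtration.

(* The counit condition is part of a, but does not follow from b: take U = K x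
   with x of degree -1, and delta = delta 0 = d/dx. *)
Theorem lemma3p2 (K : fieldType) (charK0 : [pchar K] =i pred0)
    (U : int -> lmodType K)
    (delta : nat -> {linear SymAlg U -> SymAlg U})
    (delta_deg : tser_degree1 delta)
    (delta_unit : forall n, delta n 1 = 0)
    (delta_sq : tser_square0 delta) :
  let a := IBL_infty1 delta in
  let b := forall n x, tser_conv_antipode delta n x \in lle n.+1 in
  let c := forall n k (u : 'I_k -> letter U), (1 <= k)%N ->
    koszul_bracket (delta n) (fun j => wlet [:: u j]) \in lle n.+1 in
  let d := forall n k (i : 'I_k -> nat) (x : 'I_k -> letter (gsym U)),
    (1 <= k)%N -> (forall j, (1 <= i j)%N) ->
    (forall j, lval (x j) \in lle (i j)) ->
    koszul_bracket (delta n) x \in lle ((\sum_(j < k) i j) - k + n.+1)%N in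
  [<-> b; c; d] /\ ((forall n x, counit (delta n x) = 0) -> [<-> a; b; c; d]).
Proof.
move=> a b c d.
have bE : b <-> forall n w, convs (delta n) w \in lle n.+1.
  by split=> h n; apply/conv_antipode_lle/h.
have bc : b -> c by move/bE => h n; apply/convs_lle_letters.
have cb : c -> b.
  by move=> h; apply/bE => n; apply/(convs_lle_letters (n.+1) (delta_unit n))/h.
have cd : c -> d.
  move=> /cb /bE h n k i x _ i1 xi.
  exact: (koszul_bracket_lle (delta_deg n) (delta_unit n) (h n)).
have dc : d -> c.
  move=> h n k u k1; have := h n k (fun=> 1%N) (fun j => wlet [:: u j]) k1.
  rewrite sum_nat_const card_ord muln1 subnn; apply=> // j.
  exact: word_lle.
split; first by tfae=> // /dc.
move=> delta_counit.
have abE n := convs_lle_cobracket n.+1 (delta_deg n) charK0 (delta_counit n).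
have ab : a -> b.
  (* The m-th cobracket of [delta n] vanishes modulo t^(m - 1) when n < m - 1, that is, m > n + 1,
     which also forces m >= 2. *)
  case=> _ _ _ h; apply/bE => n; apply/abE => m x nm.
  by apply: h; rewrite ?(leq_trans _ nm) // -ltnS prednK // (leq_trans _ nm).
have ba : b -> a.
  move=> /bE h; split=> // m x m2 n nm; apply: ((abE n).1 (h n)).
  by rewrite -(prednK (leq_trans _ m2)) // ltnS.
by tfae=> // /dc/cb.
Qed.
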